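(* There exist absolute constants $k_0 \ge 1$ and $\sigma > 0$ such that $$E(X;q,a) \ll \frac{X}{q^{1+\sigma}}$$ holds, with an absolute implied constant, uniformly for all real $X \ge 2$, all $q \le X^{2/3+\sigma}$ of the form $q = p^k$ with $p$ an odd prime and $k \ge k_0$ an integer, and all integers $a$ with $\gcd(a,q)=1$.
   Context: For a positive integer $n$, $d(n)$ denotes the number of positive divisors of $n$, and $\varphi$ is Euler's totient function. For integers $a$ and $q \ge 1$ with $\gcd(a,q)=1$ and for $X \ge 2$, define $$D(X;q,a) := \sum_{\substack{n \le X \\ n \equiv a \bmod q}} d(n), \qquad E(X;q,a) := D(X;q,a) - \frac{1}{\varphi(q)} \sum_{\substack{n \le X \\ \gcd(n,q)=1}} d(n),$$ where the sums are over positive integers $n$. The notation $U \ll V$ means $|U| \le cV$ for some constant $c>0$. *)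

(* Defs.v *)
From HB Require Import structures.
From mathcomp Require Import all_boot all_order all_algebra.
From mathcomp Require Import reals exp.

Set Implicit Arguments.
Unset Strict Implicit.
Unset Printing Implicit Defensive.

Import Order.TTheory GRing.Theory Num.Theory.

Local Open Scope ring_scope.

Definition num_divisors (n : nat) : nat := size (divisors n).

(* For 0 <= X, [Num.truncn X] is the integer part of X, so that the index
   ranges below are exactly the integers n with 1 <= n <= X. *)

Definition divisor_sum_ap (R : realType) (X : R) (q : nat) (a : int) : nat :=
  (\sum_(1 <= n < (Num.truncn X).+1 | (n%:Z == a %[mod q%:Z])%Z)
     num_divisors n)%N.

Definition divisor_sum_coprime (R : realType) (X : R) (q : nat) : nat :=
  (\sum_(1 <= n < (Num.truncn X).+1 | coprime n q) num_divisors n)%N.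

Definition divisor_error (R : realType) (X : R) (q : nat) (a : int) : R :=
  (divisor_sum_ap X q a)%:R
    - (totient q)%:R^-1 * (divisor_sum_coprime X q)%:R.

(* Main.v *)
Require Import Defs.
From HB Require Import structures.
From mathcomp Require Import all_boot all_order all_algebra.
From mathcomp Require Import cyclic complex.
From mathcomp Require Import classical_sets reals topology normedtype derive exp trigo.
From mathcomp Require Import ring lra zify.

Set Implicit Arguments.
Unset Strict Implicit.
Unset Printing Implicit Defensive.

Import Order.TTheory GRing.Theory Num.Theory.
Import numFieldNormedType.Exports.

Local Open Scope ring_scope.

(** The error term is the average, over the reduced classes b modulo q, of the
    difference of the divisor sums over the classes a and b, so it is enough to
    compare two reduced classes.  The divisor sum over a class counts the lattice
    points (n, m) with n m = a modulo q under a hyperbola.  Let s be a small positive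
    constant; cutting that region into about X^(6 s) thin pieces, each squeezed
    between two boxes whose difference is a box again (block_rows_diff,
    hyperbola_diff), reduces the comparison to boxes one of whose sides is at most
    2 sqrt X.

    Let q = p^k.  Completing both variables of a box turns its point count into a
    sum of Kloosterman sums S(u, v) weighted by the Fourier transforms of the two
    sides.  The frequencies divisible by p reproduce the count modulo p^(k-1) divided
    by p, so what remains is a sum over units (box_count_fourier), and the classes
    can be compared by descent on k (box_count_telescope).  Square-root cancellation
    in S(u, v) alone stops at q = X^(2/3); to pass it one must also gain from the sum
    over u, whose effective length is about q^(1/4).

    To a prime power modulus S(u, v) is governed by its stationary points x, where
    u x^2 = v modulo about p^(k/2); there are at most about sqrt q of them
    (kloosterman_stationary, card_stationary).  On a class u = u0 + p^r w one has
    u = u0 c^2 with c the truncated square root of 1 + p^r w / u0, and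
    S(u0 c^2, v) = S(u0 c, v c) has the same stationary points for all w, each of
    phase c (u0 x + v / x) (kloosterman_twist).  With r about 0.18 k this phase is a
    polynomial of degree 5 in w, whose leading coefficient has denominator about
    p^(k/10), while w runs over about p^(3k/50) values.  Four Weyl differencing steps
    then save a small power of q (weyl_bound_quintic), which survives the Fourier
    weights by Abel summation (block_sum) and yields the saving X^(-9 s) for boxes
    (box_estimate).

    Only a power of q has to be saved, and k is large, so any bounded power of p may
    be lost on the way; this is why logarithms appear as k p, why Gauss sums are never
    evaluated and why the small primes dividing 120 * 28 do no harm. *)

(** * Modulus of complex numbers and points of the unit circle *)

Section ComplexModulus.
Variable R : realType.
Local Notation C := R[i].

Definition cabs (z : C) : R := Normc.normc z.

Lemma cabsE (z : C) : `|z| = (cabs z)%:C%C.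
Proof. by case: z. Qed.

Lemma cabs_ge0 (z : C) : 0 <= cabs z.
Proof. by case: z => a b; rewrite /cabs /= sqrtr_ge0. Qed.

Lemma cabsM : {morph cabs : x y / x * y}.
Proof. exact: Normc.normcM. Qed.

Lemma cabs0 : cabs 0 = 0. Proof. exact: Normc.normc0. Qed.
Lemma cabs1 : cabs 1 = 1. Proof. exact: Normc.normc1. Qed.
Lemma cabsN (z : C) : cabs (- z) = cabs z. Proof. exact: normcN. Qed.
Lemma cabsV (z : C) : cabs z^-1 = (cabs z)^-1. Proof. exact: Normc.normcV. Qed.
Lemma cabs_eq0 (z : C) : (cabs z == 0) = (z == 0).
Proof.
apply/eqP/eqP => [/Normc.eq0_normc//|->]; exact: cabs0.
Qed.

Lemma ler_cabsD (x y : C) : cabs (x + y) <= cabs x + cabs y.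
Proof. exact: le_normcD. Qed.

Lemma ler_cabsB (x y : C) : cabs (x - y) <= cabs x + cabs y.
Proof. by rewrite -(cabsN y) ler_cabsD. Qed.

Lemma cabsBC (x y : C) : cabs (x - y) = cabs (y - x).
Proof. by rewrite -cabsN opprB. Qed.

Lemma ler_cabs_sum (I : Type) (r : seq I) (P : pred I) (F : I -> C) :
  cabs (\sum_(i <- r | P i) F i) <= \sum_(i <- r | P i) cabs (F i).
Proof.
elim/big_rec2: _ => [|i y1 y2 _ H]; first by rewrite cabs0.
by apply: le_trans (ler_cabsD _ _) _; rewrite lerD2l.
Qed.

Lemma cabs_conj (z : C) : cabs (z^*)%C = cabs z.
Proof. by case: z => a b; rewrite /cabs /= sqrrN. Qed.

Lemma cabs_sqr (z : C) : ((cabs z) ^+ 2)%:C%C = z * (z^*)%C.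
Proof. by rewrite rmorphXn /= -cabsE sqr_normc. Qed.

Lemma cabs_real (x : R) : cabs x%:C%C = `|x|.
Proof. by rewrite /cabs /= expr0n addr0 sqrtr_sqr. Qed.

Lemma cabs_nat (n : nat) : cabs n%:R = n%:R.
Proof. by rewrite -[n%:R](rmorph_nat (real_complex R)) cabs_real normr_nat. Qed.

End ComplexModulus.

Section SineBounds.
Variable R : realType.
Local Open Scope classical_set_scope.
Local Open Scope ring_scope.

Lemma sin_MVT (x : R) : 0 < x -> exists2 c, 0 < c < x & sin x = cos c * x.
Proof.
move=> x0.
have Hd y : y \in `]0, x[ -> is_derive y 1 (@sin R) (cos y) by move=> _; exact: is_derive_sin.
have Hc : {within `[0, x], continuous (@sin R)}.
  by apply: continuous_subspaceT => y; exact: continuous_sin.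
have [c] := MVT x0 Hd Hc.
by rewrite in_itv /= sin0 !subr0 => cx E; exists c.
Qed.

Lemma sin_le_id (x : R) : 0 <= x -> sin x <= x.
Proof.
rewrite le_eqVlt => /predU1P[<-|x0]; first by rewrite sin0.
have [c _ ->] := sin_MVT x0.
by rewrite ler_piMl ?cos_le1 // ltW.
Qed.

(** Halving the angle: [sin x = 2 sin (x/2) cos (x/2)], and
    [sin y >= y * cos y] while [2 (cos (x/2))^2 = 1 + cos x >= 1]. *)
Lemma sin_ge_half (x : R) : 0 <= x <= pi / 2 -> x / 2 <= sin x.
Proof.
move=> /andP[]; rewrite le_eqVlt => /predU1P[<-|x0 xpi].
  by rewrite sin0 mul0r.
have pi0 := pi_gt0 R.
have y0 : 0 < x / 2 by lra.
have [c /andP[c0 cy] Ey] := sin_MVT y0.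
have Hc : cos (x / 2) <= cos c.
  by apply/ltW; rewrite ltr_cos ?in_itv //=; apply/andP; split; lra.
have cx0 : 0 <= cos (x / 2) by apply: cos_ge0_pihalf; apply/andP; split; lra.
have Cx0 : 0 <= cos x by apply: cos_ge0_pihalf; apply/andP; split; lra.
have Ex : x = (x / 2) *+ 2 by rewrite mulr2n; field.
have E1 : sin x = (cos (x / 2) * sin (x / 2)) *+ 2 by rewrite {1}Ex sin_mulr2n.
have E2 : cos x = cos (x / 2) ^+ 2 *+ 2 - 1 by rewrite {1}Ex cos_mulr2n.
rewrite E1 Ey.
have H1 : cos (x / 2) ^+ 2 <= cos (x / 2) * cos c by rewrite expr2 ler_wpM2l.
rewrite mulrA -mulrnAl; rewrite mulr2n in E2 *; nra.
Qed.

End SineBounds.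

Section UnitCircle.
Variable R : realType.
Local Notation C := R[i].

Definition expc (x : R) : C := (cos x +i* sin x)%C.

Lemma expcD (x y : R) : expc (x + y) = expc x * expc y.
Proof.
rewrite /expc cosD sinD; apply/eqP; rewrite eq_complex /=; apply/andP; split; apply/eqP; ring.
Qed.

Lemma expc0 : expc 0 = 1.
Proof. by rewrite /expc cos0 sin0. Qed.

Lemma cabs_expc (x : R) : cabs (expc x) = 1.
Proof. by rewrite /cabs /= cos2Dsin2 sqrtr1. Qed.

Lemma expc2pi (n : nat) : expc (2 * pi * n%:R) = 1.
Proof.
elim: n => [|n IH]; first by rewrite mulr0 expc0.
rewrite -(natr1 n) mulrDr expcD IH mul1r mulr1 /expc.
have -> : 2 * pi = pi *+ 2 :> R by rewrite mulr_natl.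
by rewrite cos2pi sin2pi.
Qed.

Lemma cabs_1Bexpc (x : R) : cabs (1 - expc (2 * x)) = 2 * `|sin x|.
Proof.
rewrite /cabs /expc /= mulr_natl cos_mulr2n sin_mulr2n.
set A := (X in Num.sqrt X); have -> : A = (2 * sin x) ^+ 2.
  rewrite {}/A !mulr2n; have := cos2Dsin2 x; nra.
by rewrite sqrtr_sqr normrM ger0_norm.
Qed.

End UnitCircle.
#[global] Arguments cabs : simpl never.
#[global] Arguments expc : simpl never.

(** * Additive characters modulo q *)

Section AdditiveCharacter.
Variables (R : realType) (q : nat).
Hypothesis q_gt1 : (1 < q)%N.
Local Notation C := R[i].

Definition psi (x : 'Z_q) : C := expc (2 * pi * (x : nat)%:R / q%:R).

Let q_gt0 : 0 < q%:R :> R. Proof. by rewrite ltr0n ltnW. Qed.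

Lemma psi_nat (n : nat) : psi n%:R = expc (2 * pi * n%:R / q%:R).
Proof.
have qn0 : q%:R != 0 :> R by rewrite gt_eqF.
rewrite /psi val_Zp_nat //.
have -> : 2 * pi * n%:R / q%:R =
    2 * pi * (n %/ q)%:R + 2 * pi * (n %% q)%:R / q%:R :> R.
  by rewrite {1}(divn_eq n q) natrD natrM; field.
by rewrite expcD expc2pi mul1r.
Qed.

Lemma Zq_nat (x : 'Z_q) : x = (x : nat)%:R.
Proof. by rewrite natr_Zp. Qed.

Lemma psiD (x y : 'Z_q) : psi (x + y) = psi x * psi y.
Proof.
rewrite [x in LHS]Zq_nat [y in LHS]Zq_nat -natrD psi_nat natrD -expcD.
by congr expc; ring.
Qed.

Lemma psi0 : psi 0 = 1.
Proof. by rewrite -[0]/(0%:R) psi_nat mulr0 mul0r expc0. Qed.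

Lemma cabs_psi (x : 'Z_q) : cabs (psi x) = 1.
Proof. exact: cabs_expc. Qed.

Lemma psi_neq0 (x : 'Z_q) : psi x != 0.
Proof. by rewrite -cabs_eq0 cabs_psi oner_neq0. Qed.

Lemma psiN (x : 'Z_q) : psi (- x) = ((psi x)^*)%C.
Proof.
apply: (mulfI (psi_neq0 x)).
by rewrite -psiD subrr psi0 -cabs_sqr cabs_psi expr1n.
Qed.

Lemma psiB (x y : 'Z_q) : psi (x - y) = psi x * ((psi y)^*)%C.
Proof. by rewrite psiD psiN. Qed.

Lemma psiMn (x : 'Z_q) (n : nat) : psi (x * n%:R) = psi x ^+ n.
Proof.
elim: n => [|n IH]; first by rewrite mulr0 psi0 expr0.
by rewrite -(natr1 n) mulrDr mulr1 psiD IH exprSr.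
Qed.

Lemma cabs_1Bpsi_nat (n : nat) :
  cabs (1 - psi n%:R) = 2 * `|sin (pi * n%:R / q%:R)| :> R.
Proof. by rewrite psi_nat -cabs_1Bexpc !mulrA. Qed.

Lemma cabs_1Bpsi_le (n : nat) : cabs (1 - psi n%:R) <= 8 * n%:R / q%:R.
Proof.
rewrite cabs_1Bpsi_nat.
have n0 : 0 <= n%:R :> R := ler0n _ _.
have pi0 := pi_gt0 R; have pi2 := pihalf_lt2 R.
set y := pi * n%:R / q%:R.
have y0 : 0 <= y by rewrite /y divr_ge0 ?mulr_ge0 // ltW.
have y8 : 2 * y <= 8 * n%:R / q%:R.
  rewrite /y !mulrA ler_pM2r ?invr_gt0 //; nra.
suff: `|sin y| <= y by lra.
rewrite ler_norml sin_le_id // andbT.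
case: (leP y 1) => y1; last by have := sin_geN1 y; lra.
have : 0 <= sin y; last by lra.
apply: sin_ge0_pi; have := pi_ge2 R; lra.
Qed.

(** The two reciprocals account for [n] near [0] and [n] near [q]; a sum of both is
    easier to add up than a maximum. *)
Lemma psi_dist_nat (n : nat) : (0 < n < q)%N ->
  (cabs (1 - psi n%:R))^-1 <= q%:R / 2 * (n%:R^-1 + (q - n)%:R^-1).
Proof.
have pi0 := pi_gt0 R; have pi2 := pi_ge2 R.
(* it suffices to treat the smaller of n and q - n *)
have H (m : nat) : (0 < m)%N -> (2 * m <= q)%N ->
    (cabs (1 - psi m%:R))^-1 <= q%:R / 2 * m%:R^-1.
  move=> m0 mq; rewrite cabs_1Bpsi_nat.
  have m0' : 0 < m%:R :> R by rewrite ltr0n.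
  have mq' : 2 * m%:R <= q%:R :> R by rewrite -natrM ler_nat.
  have y2 : m%:R / q%:R <= 2^-1 :> R by rewrite ler_pdivrMr //; lra.
  have y0 : 0 < m%:R / q%:R :> R by rewrite divr_gt0.
  rewrite -mulrA; set y := m%:R / q%:R in y2 y0 *.
  have Hy : 0 <= pi * y <= pi / 2 by apply/andP; split; nra.
  have Hs := sin_ge_half Hy.
  have E : q%:R / 2 * m%:R^-1 = (2 * y)^-1.
    by rewrite /y; field; rewrite !gt_eqF.
  have S : y <= sin (pi * y) by nra.
  by rewrite E lef_pV2 ?posrE ?ger0_norm; nra.
move=> /andP[n0 nq].
have N0 : 0 <= q%:R / 2 * n%:R^-1 :> R by rewrite mulr_ge0 ?invr_ge0 ?divr_ge0 // ltW.
have M0 : 0 <= q%:R / 2 * (q - n)%:R^-1 :> R.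
  by rewrite mulr_ge0 ?invr_ge0 ?divr_ge0 // ltW.
rewrite mulrDr; case: (leqP (2 * n) q) => nq2; first by have := H _ n0 nq2; lra.
have -> : cabs (1 - psi n%:R) = cabs (1 - psi (q - n)%:R).
  rewrite natrB ?(ltnW nq) // pchar_Zp // sub0r psiN -cabs_conj.
  by rewrite rmorphB rmorph1.
have := H (q - n)%N; rewrite subn_gt0 nq => /(_ isT) H'.
have : (2 * (q - n) <= q)%N by lia.
by move/H'; lra.
Qed.

Lemma psi_eq1 (x : 'Z_q) : psi x = 1 -> x = 0.
Proof.
move=> x1; apply/eqP; apply: contraT => x0.
have x0' : (0 < x)%N.
  by rewrite lt0n; apply: contra x0 => /eqP H; apply/eqP/val_inj.
have xq : (x < q)%N by rewrite -{2}(Zp_cast q_gt1) ltn_ord.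
have : cabs (1 - psi (x : nat)%:R) = 0 by rewrite -Zq_nat x1 subrr cabs0.
rewrite cabs_1Bpsi_nat => /eqP; rewrite mulf_eq0 pnatr_eq0 /= normr_eq0 gt_eqF //.
have pi0 := pi_gt0 R.
have x0'' : 0 < (x : nat)%:R :> R by rewrite ltr0n.
apply: sin_gt0_pi; rewrite -mulrA mulr_gt0 ?divr_gt0 //=.
by rewrite gtr_pMr // ltr_pdivrMr // mul1r ltr_nat.
Qed.

Lemma psi_orthogonal (y : 'Z_q) :
  \sum_(t : 'Z_q) psi (t * y) = if y == 0 then q%:R else 0.
Proof.
have [->|y0] := eqVneq y 0.
  under eq_bigr do rewrite mulr0 psi0.
  by rewrite sumr_const card_ord Zp_cast.
set s := \sum_t _.
have E : psi y * s = s.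
  rewrite /s mulr_sumr [RHS](reindex_inj (addrI 1)) /=.
  by apply: eq_bigr => t _; rewrite mulrDl mul1r psiD.
have : (psi y - 1) * s = 0 by rewrite mulrBl E mul1r subrr.
move/eqP; rewrite mulf_eq0 subr_eq0 => /orP[/eqP/psi_eq1 H|/eqP//].
by rewrite H eqxx in y0.
Qed.

(** Multiplying by [1 - psi l] telescopes the sum to two terms of modulus 1. *)
Lemma psi_geometric (l c : 'Z_q) (n : nat) : l != 0 ->
  cabs (\sum_(w < n) psi (l * w%:R + c)) <= 2 * (cabs (1 - psi l))^-1.
Proof.
move=> l0.
have L0 : 0 < cabs (1 - psi l).
  rewrite lt_def cabs_ge0 andbT cabs_eq0 subr_eq0 eq_sym.
  by apply: contra l0 => /eqP/psi_eq1 ->.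
rewrite ler_pdivlMr //.
under eq_bigr do rewrite psiD psiMn.
rewrite -mulr_suml -cabsM mulrAC -[1 - _]opprB mulrN mulNr cabsN [_ * (_ - 1)]mulrC.
rewrite -subrX1 cabsM cabs_psi mulr1.
apply: le_trans (ler_cabsB _ _) _.
by rewrite cabs1 -psiMn cabs_psi; lra.
Qed.

End AdditiveCharacter.
#[global] Arguments psi : simpl never.

(** * Residues modulo a prime power and Kloosterman sums *)

Section PrimePowerRing.
Variables p kap : nat.
Hypotheses (p_pr : prime p) (kap_gt0 : (0 < kap)%N).
Local Notation q := (p ^ kap)%N.
Local Notation Z := 'Z_(p ^ kap).
Local Notation pr := (p%:R : Z).

Lemma ppow_gt1 : (1 < q)%N.
Proof. by rewrite -(exp1n kap) ltn_exp2r // prime_gt1. Qed.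

Let q_gt1 := ppow_gt1.

Lemma Zq_nat_eq0 (n : nat) : (n%:R == 0 :> Z) = (q %| n)%N.
Proof.
apply/eqP/idP => [H|/dvdnP[m ->]]; last by rewrite natrM pchar_Zp ?mulr0.
by rewrite /dvdn -val_Zp_nat // H.
Qed.

Lemma ppow_mul_eq0 (h : nat) (x : Z) : (h <= kap)%N ->
  (pr ^+ h * x == 0) = (p ^ (kap - h) %| (x : nat))%N.
Proof.
move=> hk; rewrite [in LHS](Zq_nat x) -natrX -natrM Zq_nat_eq0.
by rewrite -{1}(subnKC hk) expnD dvdn_pmul2l // expn_gt0 prime_gt0.
Qed.

Lemma unit_ppowE (x : Z) : (x \is a GRing.unit) = ~~ (p %| (x : nat))%N.
Proof.
by rewrite {1}(Zq_nat x) unitZpE // coprime_pexpl // prime_coprime.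
Qed.

Lemma nonunit_ppowE (x : Z) : (x \isn't a GRing.unit) = (pr ^+ kap.-1 * x == 0).
Proof.
rewrite unit_ppowE negbK ppow_mul_eq0 ?leq_pred //.
by have -> : (kap - kap.-1 = 1)%N by lia.
Qed.

Lemma unit_nat (n : nat) : (n%:R : Z) \is a GRing.unit = ~~ (p %| n)%N.
Proof. by rewrite unitZpE // coprime_pexpl // prime_coprime. Qed.

Lemma ppow_eq0 (h : nat) : (pr ^+ h == 0) = (kap <= h)%N.
Proof. by rewrite -natrX Zq_nat_eq0 dvdn_Pexp2l // prime_gt1. Qed.

Lemma ppow_annihilatorM (h h' : nat) (x : Z) : (h <= h')%N ->
  pr ^+ h * x = 0 -> pr ^+ h' * x = 0.
Proof. by move=> hh H; rewrite -(subnK hh) exprD -mulrA H mulr0. Qed.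

Lemma ppow_mul_unit_eq0 (h : nat) (u x : Z) : u \is a GRing.unit ->
  (pr ^+ h * (u * x) == 0) = (pr ^+ h * x == 0).
Proof.
by move=> uu; rewrite mulrCA (can2_eq (mulKr uu) (mulVKr uu)) mulr0.
Qed.

Lemma card_annihilator (h : nat) : (h <= kap)%N ->
  #|[set x : Z | pr ^+ h * x == 0]| = (p ^ h)%N.
Proof.
move=> hk.
have p0 : (0 < p)%N := prime_gt0 p_pr.
have lt (i : 'I_(p ^ h)) : (p ^ (kap - h) * i < (Zp_trunc (p ^ kap)).+2)%N.
  by rewrite Zp_cast // -{2}(subnK hk) expnD ltn_pmul2l ?expn_gt0 ?p0.
pose f (i : 'I_(p ^ h)) : Z := Ordinal (lt i).
have f_inj : injective f.
  move=> i j /(congr1 val) /= /eqP.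
  by rewrite eqn_pmul2l ?expn_gt0 ?p0 // => /eqP/val_inj.
have -> : [set x : Z | pr ^+ h * x == 0] = f @: [set: 'I_(p ^ h)].
  apply/setP => x; rewrite inE ppow_mul_eq0 //.
  apply/idP/imsetP => [|[i _ ->]]; last by rewrite dvdn_mulr.
  case/dvdnP => m Hm.
  have mlt : (m < p ^ h)%N.
    rewrite -(@ltn_pmul2r (p ^ (kap - h))) ?expn_gt0 ?p0 // -Hm -expnD subnKC //.
    by rewrite -[X in (_ < X)%N](Zp_cast q_gt1).
  by exists (Ordinal mlt) => //; apply: val_inj; rewrite /= Hm mulnC.
by rewrite card_imset // cardsT card_ord.
Qed.

End PrimePowerRing.

Section Kloosterman.
Variables (R : realType) (p kap : nat).
Hypotheses (p_pr : prime p) (p_odd : odd p) (kap_gt0 : (0 < kap)%N).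
Local Notation q := (p ^ kap)%N.
Local Notation Z := 'Z_(p ^ kap).
Local Notation C := R[i].
Local Notation pr := (p%:R : Z).
Let q_gt1 := ppow_gt1 p_pr kap_gt0.

Definition kloosterman (u v : Z) : C :=
  \sum_(x : Z | x \is a GRing.unit) psi R (u * x + v * x^-1).

Definition stationary (h : nat) (u v : Z) : {set Z} :=
  [set x : Z | (x \is a GRing.unit) && (pr ^+ h * (u * x - v * x^-1) == 0)].

Lemma unit2 : (2%:R : Z) \is a GRing.unit.
Proof.
rewrite unit_nat //; apply/negP => /(dvdn_leq (isT : (0 < 2)%N)).
by have := prime_gt1 p_pr; case: p p_odd => [|[|[|]]].
Qed.

(** The substitution [x -> x + p^h t] fixes the sum, and, as [p^(2h) = 0], it
    multiplies each term by [psi (p^h t (u - v / x^2))].  Averaging over [t]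
    kills every [x] at which the derivative is not divisible by [p^(kap - h)]. *)
Lemma kloosterman_stationary (h : nat) (u v : Z) : (kap <= 2 * h)%N ->
  (0 < h)%N ->
  kloosterman u v = \sum_(x in stationary h u v) psi R (u * x + v * x^-1).
Proof.
move=> kh h0.
have p2 : pr ^+ h * pr ^+ h = 0.
  by apply/eqP; rewrite -exprD ppow_eq0 // addnn -mul2n.
have shiftM (t x : Z) : x \is a GRing.unit ->
    (x + pr ^+ h * t) * (x^-1 - pr ^+ h * t * x^-1 * x^-1) = 1.
  move=> ux; have E : x^-1 * x = 1 by rewrite mulVr.
  have F : (x + pr ^+ h * t) * (x^-1 - pr ^+ h * t * x^-1 * x^-1) =
     x^-1 * x - (x^-1 * x) * (pr ^+ h * t * x^-1) + pr ^+ h * t * x^-1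
      - (pr ^+ h * pr ^+ h) * (t ^+ 2 * x^-1 * x^-1) by ring.
  by rewrite F E p2; ring.
have unitD (t x : Z) : x \is a GRing.unit -> x + pr ^+ h * t \is a GRing.unit.
  move=> ux; apply/unitrP; exists (x^-1 - pr ^+ h * t * x^-1 * x^-1).
  by split; [rewrite mulrC|]; exact: shiftM.
have invD (t x : Z) : x \is a GRing.unit ->
   (x + pr ^+ h * t)^-1 = x^-1 - pr ^+ h * t * x^-1 * x^-1.
  by move=> ux; apply: (mulrI (unitD t _ ux)); rewrite mulrV ?unitD // shiftM.
have shift t : kloosterman u v = \sum_(x : Z | x \is a GRing.unit)
    psi R (u * x + v * x^-1) * psi R (t * (pr ^+ h * x^-1 * (u * x - v * x^-1))).
  rewrite /kloosterman (reindex_inj (addIr (pr ^+ h * t))) /=.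
  apply: eq_big => [x|x /[dup] uxt].
    apply/idP/idP => [/(unitD (-t))|/(unitD t)//].
    by rewrite mulrN addrK.
  move=> H; have ux : x \is a GRing.unit.
    by have := unitD (- t) _ H; rewrite mulrN addrK.
  rewrite invD // -psiD //; congr psi.
  have E : x^-1 * x = 1 by rewrite mulVr.
  have F : t * (pr ^+ h * x^-1 * (u * x - v * x^-1)) = 
    t * pr ^+ h * u * (x^-1 * x) - t * pr ^+ h * x^-1 * x^-1 * v by ring.
  by rewrite F E; ring.
have q0 : q%:R != 0 :> C by rewrite pnatr_eq0 -lt0n expn_gt0 prime_gt0.
apply: (mulfI q0).
transitivity (\sum_(t : Z) kloosterman u v).
  by rewrite sumr_const card_ord Zp_cast // mulr_natl.
rewrite (eq_bigr _ (fun t _ => shift t)) exchange_big /=.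
rewrite mulr_sumr big_mkcond [RHS]big_mkcond /=; apply: eq_bigr => x _.
rewrite inE; case: ifP => //= ux.
rewrite -mulr_sumr psi_orthogonal //.
rewrite -mulrA ppow_mul_unit_eq0 ?unitrV //.
by case: ifP => _; [exact: mulrC|exact: mulr0].
Qed.

Lemma stationary_scale (h : nat) (u v c : Z) : c \is a GRing.unit ->
  stationary h (u * c) (v * c) = stationary h u v.
Proof.
move=> uc; apply/setP => x; rewrite !inE; congr andb.
rewrite -[RHS](@ppow_mul_unit_eq0 p kap h _ _ uc); congr (_ * _ == 0).
ring.
Qed.

(** The substitution [x -> x / c] gives [S(u c^2, v) = S(u c, v c)], whose stationary
    points do not depend on the unit [c]: as [u] varies over its square class only the
    phases move, and they move linearly in [c]. *)
Lemma kloosterman_twist (h : nat) (u v c : Z) : (kap <= 2 * h)%N -> (0 < h)%N ->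
  c \is a GRing.unit ->
  kloosterman (u * c ^+ 2) v =
    \sum_(x in stationary h u v) psi R (c * (u * x + v * x^-1)).
Proof.
move=> kh h0 uc.
transitivity (kloosterman (u * c) (v * c)).
  have uc' : c^-1 \is a GRing.unit by rewrite unitrV.
  rewrite /kloosterman (reindex_inj (mulrI uc')) /=.
  apply: eq_big => [x|x]; rewrite unitrMr // => ux.
  have E : c * c^-1 = 1 by rewrite mulrV.
  rewrite invrM ?unitrV // invrK; congr (psi R (_ + _)); last by ring.
  by rewrite -[RHS]mul1r -E; ring.
rewrite (kloosterman_stationary _ _ kh h0) stationary_scale //.
by apply: eq_bigr => x _; congr psi; ring.
Qed.

(** If exactly one of [u], [v] is a unit, then so is [u x - v / x], and there are no
    stationary points. *)
Lemma kloosterman_eq0 (h : nat) (u v : Z) : (kap <= 2 * h)%N -> (0 < h < kap)%N ->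
  (u \is a GRing.unit) != (v \is a GRing.unit) -> kloosterman u v = 0.
Proof.
move=> kh /andP[h0 hk] uv; rewrite (kloosterman_stationary _ _ kh h0).
apply: big1 => x; rewrite inE => /andP[ux /eqP /(ppow_annihilatorM (h' := kap.-1))].
have hk' : (h <= kap.-1)%N by lia.
move=> /(_ hk') H; exfalso; move/negP: uv; apply; apply/eqP.
have nu (y z : Z) : y \isn't a GRing.unit -> z \isn't a GRing.unit ->
    y + z \isn't a GRing.unit.
  rewrite !nonunit_ppowE // mulrDr => /eqP -> /eqP ->; by rewrite addr0.
have nd : u * x - v * x^-1 \isn't a GRing.unit by rewrite nonunit_ppowE // H.
apply/idP/idP => Hu; apply: contraT => Hn.
  have : u * x \isn't a GRing.unit.
    by rewrite -[u * x](subrK (v * x^-1)) nu // unitrMl ?unitrV.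
  by rewrite unitrMl // Hu.
have : v * x^-1 \isn't a GRing.unit.
  have -> : v * x^-1 = - (u * x - v * x^-1) + u * x by ring.
  by rewrite nu ?unitrN // unitrMl.
by rewrite unitrMl ?unitrV // Hu.
Qed.

(** At a stationary point [u x = v / x] modulo [p], so the phase is [2 u x]
    modulo [p]. *)
Lemma stationary_phase_unit (h : nat) (u v x : Z) : (h < kap)%N ->
  u \is a GRing.unit -> x \in stationary h u v ->
  u * x + v * x^-1 \is a GRing.unit.
Proof.
move=> hk uu; rewrite inE => /andP[ux /eqP].
have hk' : (h <= kap.-1)%N by lia.
move=> /(ppow_annihilatorM hk') H; apply: contraT; rewrite nonunit_ppowE // => /eqP K.
have : 2%:R * u * x \isn't a GRing.unit.
  rewrite nonunit_ppowE //; apply/eqP.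
  rewrite -[RHS](addr0 0) -{1}H -K; ring.
by rewrite !unitrM unit2 uu ux.
Qed.

(** Two stationary points satisfy [p^h (x - x0) (x + x0) = 0]; as [2 x] is a unit, one
    of the two factors is a unit and the other is killed by [p^h]. *)
Lemma card_stationary (h : nat) (u v : Z) : (h < kap)%N ->
  u \is a GRing.unit -> (#|stationary h u v| <= 2 * p ^ h)%N.
Proof.
move=> hk uu; have hk' : (h <= kap.-1)%N by lia.
have [->|[x0 x0S]] := set_0Vmem (stationary h u v); first by rewrite cards0.
pose A := [set y : Z | pr ^+ h * y == 0].
have cA (b : Z) (f : Z -> Z) : injective f -> #|f @: A| = (p ^ h)%N.
  by move=> fi; rewrite card_imset // card_annihilator // ltnW.
have sub : stationary h u v \subset
    (fun y => x0 + y) @: A :|: (fun y => - x0 + y) @: A.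
  apply/fintype.subsetP => x xS; move: (xS) (x0S); rewrite !inE.
  move=> /andP[ux /eqP Hx] /andP[ux0 /eqP Hx0].
  have prod0 : pr ^+ h * ((x - x0) * (x + x0)) = 0.
    apply/eqP; rewrite -(@ppow_mul_unit_eq0 p kap h _ _ uu); apply/eqP.
    have E : x^-1 * x = 1 by rewrite mulVr.
    have E0 : x0^-1 * x0 = 1 by rewrite mulVr.
    have -> : pr ^+ h * (u * ((x - x0) * (x + x0))) =
       x * (pr ^+ h * (u * x - v * (x^-1))) + pr ^+ h * v * (x^-1 * x) -
       (x0 * (pr ^+ h * (u * x0 - v * (x0^-1))) + pr ^+ h * v * (x0^-1 * x0)) by ring.
    by rewrite Hx Hx0 E E0; ring.
  apply/orP; have [up|np] := boolP (x + x0 \is a GRing.unit).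
    left; apply/imsetP; exists (x - x0); last by ring.
    rewrite inE -(@ppow_mul_unit_eq0 p kap h _ _ up); apply/eqP.
    by rewrite -[RHS]prod0; ring.
  have um : x - x0 \is a GRing.unit.
    apply: contraT; move: np; rewrite !nonunit_ppowE // => /eqP K1 /eqP K2.
    have : 2%:R * x \isn't a GRing.unit.
      rewrite nonunit_ppowE //; apply/eqP.
      by rewrite -[RHS](addr0 0) -{1}K1 -K2; ring.
    by rewrite unitrM unit2 ux.
  right; apply/imsetP; exists (x + x0); last by ring.
  by rewrite inE -(@ppow_mul_unit_eq0 p kap h _ _ um) prod0.
apply: leq_trans (subset_leq_card sub) _.
apply: leq_trans (leq_card_setU _ _) _.
by rewrite !cA ?mul2n ?addnn //; exact: addrI.
Qed.

End Kloosterman.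

(** * Weyl differencing *)

Section WeylSums.
Variables (R : realType) (q : nat).
Hypothesis q_gt1 : (1 < q)%N.
Local Notation C := R[i].
Local Notation Z := 'Z_q.

Definition expsum (f : nat -> Z) (n : nat) : C := \sum_(w < n) psi R (f w).

(** The polynomial phases of degree [d + 1], described by their iterated differences:
    [l] is [(d + 1)!] times the leading coefficient, the only one that the Weyl bounds
    depend on. *)
Fixpoint weyl_class (d : nat) (l : Z) (f : nat -> Z) : Prop :=
  if d is d'.+1 then
    forall h : nat, weyl_class d' (l * h%:R) (fun w => f (w + h)%N - f w)
  else exists c, forall w : nat, f w = l * w%:R + c.

Lemma expsum_le (f : nat -> Z) (n : nat) : cabs (expsum f n) <= n%:R.
Proof.
apply: le_trans (ler_cabs_sum _ _ _) _.
under eq_bigr do rewrite cabs_psi.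
by rewrite sumr_const card_ord.
Qed.

(** Expanding the square gives all pairs of terms; they are grouped by the distance
    [h + 1] of their indices, and each distance occurs with both signs. *)
Lemma weyl_differencing (f : nat -> Z) (n : nat) :
  cabs (expsum f n) ^+ 2 <= n%:R +
    2 * \sum_(h < n) cabs (expsum (fun w => f (w + h.+1)%N - f w) (n - h.+1)).
Proof.
pose A h m := expsum (fun w => f (w + h.+1)%N - f w) (m - h.+1).
have conjP w : (psi R (f w))^*%C = psi R (- f w) by rewrite psiN.
have conjD (x y : C) : (x + y)^*%C = x^*%C + y^*%C by exact: rmorphD.
have E m : expsum f m * ((expsum f m)^*)%C =
    m%:R + \sum_(h < m) (A h m + ((A h m)^*)%C).
  elim: m => [|m IH]; first by rewrite /expsum !big_ord0 mul0r addr0.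
  have St : expsum f m.+1 = expsum f m + psi R (f m) by rewrite /expsum big_ord_recr.
  have Al : A m m.+1 = 0 by rewrite /A subnn /expsum big_ord0.
  have As : \sum_(h < m) A h m.+1 =
      \sum_(h < m) A h m + psi R (f m) * ((expsum f m)^*)%C.
    have -> : (expsum f m)^*%C = \sum_(h < m) psi R (- f (m - h.+1)%N).
      rewrite /expsum rmorph_sum /= (reindex_inj rev_ord_inj) /=.
      by apply: eq_bigr => h _; rewrite -conjP.
    rewrite mulr_sumr -big_split /=; apply: eq_bigr => h _.
    rewrite /A subSn // /expsum big_ord_recr /=; congr (_ + _).
    by rewrite subnK // psiD.
  have As' : \sum_(h < m) (A h m.+1)^*%C =
      \sum_(h < m) (A h m)^*%C + ((psi R (f m))^*)%C * expsum f m.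
    rewrite -!rmorph_sum As rmorphD rmorphM /=; congr (_ + _ * _).
    exact: conjcK.
  have Z1 : psi R (f m) * (psi R (f m))^*%C = 1 by rewrite -psiB // subrr psi0.
  move: (psi R (f m)) St As As' Z1 => z St As As' Z1.
  rewrite St conjD mulrDl !mulrDr IH Z1 big_ord_recr /= Al.
  have -> : (0 : C)^*%C = 0 by rewrite rmorph0.
  rewrite !big_split /= As As' -(natr1 m).
  by ring.
rewrite -[X in X <= _]ger0_norm ?sqr_ge0 // -cabs_real cabs_sqr E.
apply: le_trans (ler_cabsD _ _) _; rewrite cabs_nat lerD2l.
apply: le_trans (ler_cabs_sum _ _ _) _.
rewrite mulr_sumr; apply: ler_sum => h _.
by apply: le_trans (ler_cabsD _ _) _; rewrite cabs_conj; lra.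
Qed.

Lemma weyl_quintic (c0 c1 c2 c3 c4 c5 : Z) :
  weyl_class 4 (120%:R * c5)
    (fun w => c0 + c1 * w%:R + c2 * w%:R ^+ 2 + c3 * w%:R ^+ 3
              + c4 * w%:R ^+ 4 + c5 * w%:R ^+ 5).
Proof.
move=> h1 h2 h3 h4 /=.
match goal with |- exists c, forall w, @?f w = _ => exists (f 0%N) end.
by move=> w /=; rewrite !natrD; ring.
Qed.

End WeylSums.

(** * Weyl bounds modulo a prime power *)

Section InverseDistances.
Variables (R : realType) (p : nat).
Hypothesis p_pr : prime p.
Let p0 : (0 < p)%N := prime_gt0 p_pr.

(** Each range from [p^i] to [p^(i+1)] contributes less than [p]. *)
Lemma harmonic_ppow (j : nat) :
  \sum_(1 <= y < p ^ j) (y%:R)^-1 <= (j * p)%:R :> R.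
Proof.
elim: j => [|j IH]; first by rewrite expn0 big_geq.
have pj : (0 < p ^ j)%N by rewrite expn_gt0 p0.
rewrite (@big_cat_nat _ _ _ (p ^ j)) //=; last by rewrite leq_exp2l // prime_gt1.
rewrite mulSn natrD addrC lerD //.
apply: (@le_trans _ _ (\sum_(p ^ j <= y < p ^ j.+1) ((p ^ j)%:R)^-1)).
  apply: ler_sum_nat => y /andP[y1 _].
  by rewrite lef_pV2 ?posrE ?ltr0n ?ler_nat // (leq_trans pj).
rewrite sumr_const_nat -[X in X <= _]mulr_natl ler_pdivrMr ?ltr0n // -natrM ler_nat.
by rewrite expnS leq_subr.
Qed.

(** The arguments are equally spaced on the circle with spacing [p^(s - kap)], so
    this is a harmonic sum scaled by [p^(kap - s)]. *)
Lemma sum_psi_dist (kap s : nat) : (s <= kap)%N -> (0 < kap)%N ->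
  \sum_(1 <= m < p ^ (kap - s))
     (cabs (1 - psi R ((p ^ s * m)%:R : 'Z_(p ^ kap))))^-1
  <= (p ^ (kap - s))%:R * (kap * p)%:R.
Proof.
move=> sk k0; have q1 := ppow_gt1 p_pr k0.
set Q := (p ^ (kap - s))%N.
have q_eq : (p ^ kap = p ^ s * Q)%N by rewrite /Q -expnD subnKC.
have ps0 : (0 < p ^ s)%N by rewrite expn_gt0 p0.
have Q0 : (0 < Q)%N by rewrite expn_gt0 p0.
apply: (@le_trans _ _ (\sum_(1 <= m < Q) (Q%:R / 2 * (m%:R^-1 + (Q - m)%:R^-1)))).
  apply: ler_sum_nat => m /andP[m0 mQ].
  have /(psi_dist_nat R q1) : (0 < p ^ s * m < p ^ kap)%N.
    by rewrite muln_gt0 ps0 m0 q_eq ltn_pmul2l.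
  move/le_trans; apply; rewrite q_eq -mulnBr !natrM.
  rewrite le_eqVlt; apply/orP; left; apply/eqP.
  by field; rewrite !pnatr_eq0 -!lt0n ps0 m0 subn_gt0 mQ //.
rewrite -mulr_sumr big_split /=.
have -> : \sum_(1 <= m < Q) ((Q - m)%:R^-1 : R) = \sum_(1 <= m < Q) m%:R^-1.
  rewrite big_nat_rev /=; apply: eq_big_nat => m /andP[m0 mQ].
  by congr (_%:R^-1); lia.
have H := harmonic_ppow (kap - s).
have H' : ((kap - s) * p)%:R <= (kap * p)%:R :> R.
  by rewrite ler_nat leq_pmul2r // leq_subr.
have QR : 0 <= Q%:R :> R by rewrite ler0n.
rewrite -/Q in H; rewrite -mulrA ler_wpM2l //; lra.
Qed.

Lemma sum_Zq (T : nmodType) (q : nat) (F : 'Z_q -> T) : (1 < q)%N ->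
  \sum_(z : 'Z_q) F z = \sum_(0 <= n < q) F n%:R.
Proof.
move=> q1; transitivity (\sum_(0 <= n < (Zp_trunc q).+2) F n%:R).
  by rewrite big_mkord; apply: eq_bigr => z _; rewrite {1}(Zq_nat z).
by rewrite Zp_cast.
Qed.

Lemma sum_psi_dist_neq0 (kap : nat) : (0 < kap)%N ->
  \sum_(z : 'Z_(p ^ kap) | z != 0) (cabs (1 - psi R z))^-1
  <= (p ^ kap)%:R * (kap * p)%:R.
Proof.
move=> k0; have q1 := ppow_gt1 p_pr k0.
have := @sum_psi_dist kap 0 (leq0n _) k0.
rewrite subn0 expn0 => H; apply: le_trans H.
rewrite big_mkcond /= sum_Zq // (@big_ltn _ _ _ 0) ?(ltnW q1) //=. rewrite add0r.
apply: ler_sum_nat => m _; rewrite mul1n; case: ifP => // _.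
by rewrite invr_ge0 cabs_ge0.
Qed.

End InverseDistances.

Section WeylBounds.
Variables (R : realType) (p kap : nat).
Hypotheses (p_pr : prime p) (kap_gt0 : (0 < kap)%N).
Local Notation q := (p ^ kap)%N.
Local Notation Z := 'Z_(p ^ kap).
Local Notation pr := (p%:R : Z).
Let q_gt1 := ppow_gt1 p_pr kap_gt0.
Let p0 : (0 < p)%N := prime_gt0 p_pr.

(** The valuation of the leading coefficient ranges over an interval because a
    differencing step multiplies this coefficient by the shift, which may be divisible
    by a power of [p]. *)
Definition weyl_bound (d s0 s1 T : nat) (B : R) : Prop :=
  forall (s : nat) (u : Z) (f : nat -> Z) (n : nat),
    u \is a GRing.unit -> (s0 <= s <= s1)%N ->
    weyl_class d (u * pr ^+ s) f -> (n <= T)%N -> cabs (expsum R f n) <= B.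

(** One differencing step leaves linear phases of slopes [u p^s h].  As [h] stays below
    [p^(kap - s)], these are distinct nonzero multiples of [p^s], so the geometric sums
    add up to at most a harmonic sum. *)
Lemma weyl_bound_quadratic (s0 s1 t : nat) (B : R) : (s1 + t < kap)%N ->
  (p ^ t)%:R + 4 * ((p ^ (kap - s0))%:R * (kap * p)%:R) <= B ^+ 2 -> 0 <= B ->
  weyl_bound 1 s0 s1 (p ^ t) B.
Proof.
move=> st HB B0 s u f n uu /andP[s0s ss1] Hf nT.
rewrite -(@ler_pXn2r _ 2) ?nnegrE ?cabs_ge0 //.
apply: le_trans HB; apply: le_trans (weyl_differencing R q_gt1 f n) _.
apply: lerD; first by rewrite ler_nat.
have sk : (s <= kap)%N by lia.
set Q := (p ^ (kap - s))%N.
have Q0 : (0 < Q)%N by rewrite expn_gt0 p0.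
have tQ : (p ^ t < Q)%N by rewrite ltn_exp2l ?prime_gt1 //; lia.
pose m (h : nat) := (((u : nat) * h.+1) %% Q)%N.
have uQ : coprime Q u.
  rewrite coprimeXl // coprime_sym; move: uu; rewrite unit_ppowE // => nd.
  by rewrite coprime_sym prime_coprime.
have lE h : u * pr ^+ s * h.+1%:R = (p ^ s * m h)%:R.
  rewrite [u in LHS](Zq_nat u) -natrX -!natrM; apply/eqP; rewrite -subr_eq0.
  have -> : (u * p ^ s * h.+1 = p ^ s * m h + p ^ s * Q * ((u * h.+1) %/ Q))%N.
    transitivity (p ^ s * (u * h.+1))%N; first by rewrite mulnCA mulnA.
    by rewrite {1}(divn_eq (u * h.+1) Q) mulnDr addnC -mulnA [(Q * _)%N]mulnC.
  rewrite natrD addrAC subrr add0r Zq_nat_eq0 //.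
  by rewrite /Q -expnD subnKC // dvdn_mulr.
have m0 h : (h < n)%N -> (0 < m h)%N.
  move=> hn; rewrite lt0n -/(dvdn _ _) Gauss_dvdr //.
  by apply/negP => /(dvdn_leq (ltn0Sn _)); lia.
have mQ h : (m h < Q)%N by rewrite ltn_mod.
have minj : {in [pred h | (h < n)%N] &, injective m}.
  move=> h h'; rewrite !inE => hn hn'.
  wlog : h h' hn hn' / (h <= h')%N.
    by move=> H; case/orP: (leq_total h h') => ? ?; [|symmetry]; apply: H.
  move=> hh /eqP; rewrite eq_sym eqn_mod_dvd ?leq_mul // -mulnBr Gauss_dvdr // subSS.
  case: (posnP (h' - h)%N) => [|h0 /(dvdn_leq h0)]; lia.
apply: (@le_trans _ _ (2 * \sum_(h < n) (2 * (cabs (1 - psi R ((p ^ s * m h)%:R : Z)))^-1))).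
  rewrite ler_pM2l //; apply: ler_sum => h _.
  have [c Hc] := Hf h.+1.
  rewrite /expsum; under eq_bigr do rewrite Hc.
  rewrite -lE; apply: psi_geometric => //; rewrite lE Zq_nat_eq0 //.
  rewrite -(subnKC sk) expnD dvdn_pmul2l ?expn_gt0 ?p0 //.
  by apply/negP => /(dvdn_leq (m0 _ (ltn_ord h))); rewrite leqNgt mQ.
rewrite -mulr_sumr mulrA -natrM ler_pM2l //.
pose g (j : nat) := (cabs (1 - psi R ((p ^ s * j)%:R : Z)))^-1.
have g0 j : 0 <= g j by rewrite invr_ge0 cabs_ge0.
have QQ : Q%:R * (kap * p)%:R <= (p ^ (kap - s0))%:R * (kap * p)%:R :> R.
  by rewrite -!natrM ler_nat leq_pmul2r ?muln_gt0 ?kap_gt0 // leq_exp2l ?prime_gt1 // leq_sub2l.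
apply: le_trans QQ; apply: le_trans (sum_psi_dist R p_pr sk kap_gt0).
rewrite -/Q -/g.
pose mo (h : 'I_n) : 'I_Q := Ordinal (mQ h).
have moinj : injective mo.
  by move=> h h' /(congr1 val) /= /minj H; apply: val_inj; apply: H; rewrite inE.
have -> : \sum_(h < n) g (m h) = \sum_(j in mo @: [set: 'I_n]) g j.
  rewrite big_imset /=; last by move=> ? ? _ _; exact: moinj.
  by apply: eq_bigl => h; rewrite inE.
rewrite big_geq_mkord big_mkcond [X in _ <= X]big_mkcond /=; apply: ler_sum => j _.
case: imsetP => [[h _ ->] /=|_]; first by rewrite m0.
by case: ifP => // _; exact: g0.
Qed.

(** A shift not divisible by [p^g] raises the valuation of the leading coefficient by
    less than [g]; the other shifts are a proportion [p^(-g)] of all of them and are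
    bounded trivially. *)
Lemma weyl_bound_step (d s0 s1 T g : nat) (B B' : R) : (g <= s1)%N ->
  weyl_bound d s0 s1 T B -> 0 <= B -> 0 <= B' ->
  T%:R + 2 * (T%:R * B + T%:R * T%:R / (p ^ g)%:R) <= B' ^+ 2 ->
  weyl_bound d.+1 s0 (s1 - g) T B'.
Proof.
move=> gs HB B0 B'0 H s u f n uu /andP[s0s ss1] Hf nT.
rewrite -(@ler_pXn2r _ 2) ?nnegrE ?cabs_ge0 //.
apply: le_trans H; apply: le_trans (weyl_differencing R q_gt1 f n) _.
apply: lerD; first by rewrite ler_nat.
rewrite ler_pM2l //.
apply: (@le_trans _ _ (\sum_(h < n) (B + T%:R * (p ^ g %| h.+1)%N%:R))).
  apply: ler_sum => h _; have hn := ltn_ord h.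
  have hT : (n - h.+1 <= T)%N by lia.
  have [dv|nd] := boolP (p ^ g %| h.+1)%N.
    rewrite mulr1; apply: le_trans (expsum_le _ _ _) _ => //.
    by apply: (@le_trans _ _ T%:R); rewrite ?ler_nat // lerDr.
  rewrite mulr0 addr0.
  have [v [h' h'E ph']] : exists2 v : nat, exists2 h', h.+1 = (p ^ v * h')%N & ~~ (p %| h')%N & (v < g)%N.
    have [h' ph' E] := pfactor_coprime p_pr (ltn0Sn h).
    exists (logn p h.+1).
      exists h'; first by rewrite mulnC.
      by rewrite -prime_coprime.
    by rewrite ltnNge; apply: contra nd => ?; rewrite pfactor_dvdn.
  move=> vg; apply: (HB (s + v)%N (u * h'%:R)) => //.
  - by rewrite unitrM uu unit_nat.
  - by apply/andP; split; lia.
  - have -> : u * h'%:R * pr ^+ (s + v) = u * pr ^+ s * h.+1%:R.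
      by rewrite h'E natrM natrX exprD; ring.
    exact: Hf.
rewrite big_split /= sumr_const card_ord -mulr_sumr.
rewrite -[B *+ n]mulr_natl; apply: lerD.
  by rewrite ler_wpM2r // ler_nat.
rewrite -mulrA ler_wpM2l //.
have -> : \sum_(h < n) ((p ^ g %| h.+1)%N%:R : R) = (n %/ p ^ g)%:R.
  rewrite divn_count_dvd -natr_sum; congr (_%:R).
  by rewrite big_add1 /= big_mkord.
rewrite ler_pdivlMr ?ltr0n ?expn_gt0 ?p0 // -natrM ler_nat.
exact: leq_trans (leq_trunc_div _ _) nT.
Qed.

End WeylBounds.

(** * Quintic phases *)

(** The Taylor polynomial of [sqrt (1 + 4 z)], whose coefficients are twice the Catalan
    numbers with alternating signs, hence integers. *)
Definition sqrt_trunc (A : comNzRingType) (z : A) : A :=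
  1 + 2%:R * z - 2%:R * z ^+ 2 + 4%:R * z ^+ 3 - 10%:R * z ^+ 4 + 28%:R * z ^+ 5.

Lemma sqrt_trunc_sqr (A : comNzRingType) (z : A) : z ^+ 6 = 0 -> sqrt_trunc z ^+ 2 = 1 + 4%:R * z.
Proof.
move=> z6; rewrite /sqrt_trunc.
have -> : forall y : A, (1 + 2%:R * y - 2%:R * y ^+ 2 + 4%:R * y ^+ 3
      - 10%:R * y ^+ 4 + 28%:R * y ^+ 5) ^+ 2 = 1 + 4%:R * y + y ^+ 6 * 
   (168%:R - 192%:R * y + 324%:R * y ^+ 2 - 560%:R * y ^+ 3 + 784%:R * y ^+ 4).
  by move=> y; ring.
by rewrite z6 mul0r addr0.
Qed.

Section QuinticData.
Variables p kap : nat.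
Hypotheses (p_pr : prime p) (p_odd : odd p) (kap_gt0 : (0 < kap)%N).
Local Notation Z := 'Z_(p ^ kap).
Local Notation pr := (p%:R : Z).

Lemma p_ge3 : (3 <= p)%N.
Proof. by have := prime_gt1 p_pr; case: p p_odd => [|[|[|]]]. Qed.

Lemma unit_1D_ppow (r : nat) (y : Z) : (0 < r)%N -> 1 + pr ^+ r * y \is a GRing.unit.
Proof.
move=> r0; apply: contraT; rewrite nonunit_ppowE  //.
have -> : pr ^+ kap.-1 * (1 + pr ^+ r * y) = pr ^+ kap.-1 + pr ^+ (kap.-1 + r) * y.
  by rewrite exprD; ring.
have /eqP -> : pr ^+ (kap.-1 + r) == 0 by rewrite ppow_eq0  //; lia.
rewrite mul0r addr0 ppow_eq0  //; lia.
Qed.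

(** [120 * 28 = 2^5 * 3 * 5 * 7] is divisible by an odd prime at most once. *)
Lemma quintic_coef_valuation :
  exists e (u : Z), [/\ u \is a GRing.unit, (e <= 1)%N & 3360%:R = u * pr ^+ e].
Proof.
have [dv|nd] := boolP (p %| 3360)%N; last first.
  by exists 0%N, 3360%:R; rewrite unit_nat // expr0 mulr1.
have : (p \in primes 3360) by rewrite mem_primes p_pr dv.
rewrite (_ : primes 3360 = [:: 2; 3; 5; 7]%N); last by vm_compute.
rewrite !inE => /or4P[] /eqP pE.
- by move: p_odd; rewrite pE.
- exists 1%N, 1120%:R; rewrite unit_nat // pE; split=> //.
  by rewrite expr1 -natrM.
- exists 1%N, 672%:R; rewrite unit_nat // pE; split=> //.
  by rewrite expr1 -natrM.
- exists 1%N, 480%:R; rewrite unit_nat // pE; split=> //.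
  by rewrite expr1 -natrM.
Qed.

End QuinticData.

Section QuinticBound.
Variables (R : realType) (p kap m : nat).
Hypotheses (p_pr : prime p) (p_odd : odd p).
Hypotheses (m_big : (17 * 20 <= m)%N) (kap_ge : (50 * (20 * m) <= kap)%N)
  (kap_lt : (kap < 50 * (20 * m.+1))%N).
Local Notation q := (p ^ kap)%N.
Local Notation Z := 'Z_(p ^ kap).
Local Notation pr := (p%:R : Z).
Local Notation D := ((p ^ m)%:R : R).

Let mod_gt0 : (0 < kap)%N. Proof. by move: m_big kap_ge; clear; lia. Qed.

Let q_gt1 := ppow_gt1 p_pr mod_gt0.
Let p0 : (0 < p)%N := prime_gt0 p_pr.

(** Lets factors [kap], which stand for logarithms of the modulus, be absorbed in [D]. *)
Lemma exponent_le_ppow : (kap <= p ^ m)%N.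
Proof.
apply: (@leq_trans (2 ^ m)); last by rewrite leq_exp2r ?prime_gt1 //; lia.
have H j : (50 * (20 * (j + 16)) <= 2 ^ (j + 15))%N.
  elim: j => [|j IH]; first by rewrite !add0n (_ : 2 ^ 15 = 128 * (16 * 16))%N //; lia.
  rewrite !addSn expnS; lia.
have := H (m - 15)%N; have -> : (m - 15 + 15 = m)%N by lia.
lia.
Qed.

Lemma weyl_bound_le (d s0 s1 s1' T : nat) (B : R) : (s1' <= s1)%N ->
  weyl_bound p kap d s0 s1 T B -> weyl_bound p kap d s0 s1' T B.
Proof.
move=> ss H s u f n uu /andP[h1 h2]; apply: H => //.
by rewrite h1 (leq_trans h2).
Qed.

(** With [T = D^60] the quadratic bound is [T / D^8]; each of the three following steps
    takes a square root of the saving, and gives up a valuation of at most [8 m].  What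
    makes the quadratic bound nontrivial is that [T^2] exceeds the denominator
    [p^(kap - 900 m)] of the leading coefficient by a factor of about [D^20]. *)
Lemma weyl_bound_quintic :
  weyl_bound p kap 4 (45 * (20 * m)) (45 * (20 * m)).+1 (p ^ (3 * (20 * m))) (3 * D ^+ 59).
Proof.
have D1 : 1 <= D by rewrite ler1n expn_gt0 p0.
have D0 : 0 < D by apply: lt_le_trans D1.
have Dn0 : D != 0 by rewrite gt_eqF.
have DX n : (p ^ (n * m))%:R = D ^+ n by rewrite mulnC expnM natrX.
have DX0 n : 0 <= D ^+ n by rewrite exprn_ge0 // ltW.
have DXle i j : (i <= j)%N -> D ^+ i <= D ^+ j by move=> ?; rewrite ler_weXn2l.
have W1 : weyl_bound p kap 1 (45 * (20 * m)) (kap - 3 * (20 * m)).-1 (p ^ (3 * (20 * m))) (D ^+ 52).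
  apply: (weyl_bound_quadratic p_pr mod_gt0) => //; first by lia.
  have -> : D ^+ 52 ^+ 2 = (p ^ (5 * (20 * m) + 4 * m))%:R.
    by rewrite expnD natrM mulnA !DX -exprD -exprM.
  rewrite -!natrM -natrD ler_nat.
  have h4 : (4 <= p ^ 2)%N by have := p_ge3 p_pr p_odd; nia.
  have h0 := exponent_le_ppow.
  have [A EA] : exists A, (A = 5 * (20 * m) + 4 * m)%N by eexists.
  have h1 : (4 * (p ^ (kap - 45 * (20 * m)) * (kap * p)) <= p ^ A.-1)%N.
    apply: (@leq_trans (p ^ 2 * (p ^ (kap - 45 * (20 * m)) * (p ^ m * p)))%N).
      by apply: leq_mul h4 _; apply: leq_mul => //; rewrite leq_pmul2r.
    rewrite -expnSr -!expnD leq_exp2l ?prime_gt1 //; lia.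
  have h3 : (p ^ (3 * (20 * m)) <= p ^ A.-1)%N by rewrite leq_exp2l ?prime_gt1 //; lia.
  have h5 : (p ^ A = p * p ^ A.-1)%N by rewrite -expnS; congr (_ ^ _)%N; lia.
  rewrite -EA h5; have := p_ge3 p_pr p_odd; nia.
have HT : (p ^ (3 * (20 * m)))%:R = D ^+ 60 by rewrite mulnA DX.
have step d s1 B B' : (8 * m <= s1)%N ->
    weyl_bound p kap d (45 * (20 * m)) s1 (p ^ (3 * (20 * m))) B -> 0 <= B -> 0 <= B' ->
    D ^+ 60 + 2 * (D ^+ 60 * B + D ^+ 112) <= B' ^+ 2 ->
    weyl_bound p kap d.+1 (45 * (20 * m)) (s1 - 8 * m) (p ^ (3 * (20 * m))) B'.
  move=> hs W B0 B'0 H; apply: (weyl_bound_step p_pr mod_gt0 hs W) => //.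
  by rewrite HT DX -exprD -expfB.
have E60 := DXle 60 112 isT.
have W2 : weyl_bound p kap 2 (45 * (20 * m)) ((kap - 3 * (20 * m)).-1 - 8 * m) (p ^ (3 * (20 * m))) (3 * D ^+ 56).
  apply: step W1 _ _ _; [lia|exact: DX0|by rewrite mulr_ge0|].
  rewrite exprMn -exprM -exprD; have := DX0 112%N; lra.
have W3 : weyl_bound p kap 3 (45 * (20 * m)) ((kap - 3 * (20 * m)).-1 - 8 * m - 8 * m) (p ^ (3 * (20 * m))) (3 * D ^+ 58).
  apply: step W2 _ _ _; [lia|by rewrite mulr_ge0|by rewrite mulr_ge0|].
  rewrite exprMn -exprM mulrCA -exprD; have := DXle 112 116 isT; have := DX0 116%N; lra.
have W4 : weyl_bound p kap 4 (45 * (20 * m)) ((kap - 3 * (20 * m)).-1 - 8 * m - 8 * m - 8 * m) (p ^ (3 * (20 * m))) (3 * D ^+ 59).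
  apply: step W3 _ _ _; [lia|by rewrite mulr_ge0|by rewrite mulr_ge0|].
  rewrite exprMn -exprM mulrCA -exprD; have := DXle 112 118 isT; have := DX0 118%N; lra.
apply: weyl_bound_le W4; lia.
Qed.

(** The linear term [c0 + c1 w] is free: it does not change the leading coefficient of
    the quintic. *)
Lemma quintic_phase_sum (th b c0 c1 : Z) (n : nat) :
  th \is a GRing.unit -> b \is a GRing.unit -> (n <= p ^ (3 * (20 * m)))%N ->
  cabs (\sum_(w < n) psi R (th * sqrt_trunc (pr ^+ (9 * (20 * m)) * b * w%:R)
                             + (c0 + c1 * w%:R))) <= 3 * D ^+ 59.
Proof.
move=> uth ub nT.
have E5 : (9 * (20 * m) * 5 = 45 * (20 * m))%N by lia.
have [e [u [uu e1 uE]]] := quintic_coef_valuation p_pr p_odd mod_gt0.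
set z := pr ^+ (9 * (20 * m)) * b.
pose f (w : nat) : Z := th * sqrt_trunc (z * w%:R) + (c0 + c1 * w%:R).
have cl : weyl_class 4 (u * th * b ^+ 5 * pr ^+ (45 * (20 * m) + e)) f.
  have -> : u * th * b ^+ 5 * pr ^+ (45 * (20 * m) + e) = 120%:R * (th * 28%:R * z ^+ 5).
    have -> : 120%:R * (th * 28%:R * z ^+ 5) = 3360%:R * (th * z ^+ 5) by ring.
    rewrite uE /z exprMn -exprM exprD.
    by rewrite E5; ring.
  have := weyl_quintic (c0 + th) (c1 + th * 2%:R * z) (- (th * 2%:R * z ^+ 2))
    (th * 4%:R * z ^+ 3) (- (th * 10%:R * z ^+ 4)) (th * 28%:R * z ^+ 5).
  have ext d l g g' : g =1 g' -> weyl_class d l g -> weyl_class (q := q) d l g'.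
    elim: d l g g' => [|d IH] l g g' E /=.
      by move=> [c Hc]; exists c => w; rewrite -E.
    by move=> H h; apply: IH (H h) => w; rewrite !E.
  by apply: ext => w; rewrite /f /sqrt_trunc; ring.
have := weyl_bound_quintic; move/(_ _ _ f n _ _ cl nT); apply.
  by rewrite unitrM (unitrM u) uu uth unitrX.
by rewrite leq_addr -[X in (_ <= X)%N]addn1 leq_add2l.
Qed.

End QuinticBound.

(** * Abel summation against the Fourier transform of an interval *)

Section AbelSummation.
Variable R : realType.
Local Notation C := R[i].

Lemma abel_summation (a b : nat -> C) (M A d : R) (T : nat) :
  0 <= A -> 0 <= d ->
  (forall n, (n <= T)%N -> cabs (\sum_(w < n) b w) <= M) ->
  (forall w, (w < T)%N -> cabs (a w) <= A) ->
  (forall w, (w.+1 < T)%N -> cabs (a w.+1 - a w) <= d) ->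
  cabs (\sum_(w < T) a w * b w) <= M * (A + T%:R * d).
Proof.
move=> A0 d0 HS HA Hd.
have M0 : 0 <= M by have := HS 0%N (leq0n _); rewrite big_ord0 cabs0.
case: T HS HA Hd => [|T] HS HA Hd.
  by rewrite big_ord0 cabs0 mul0r addr0 mulr_ge0.
have E n : \sum_(w < n.+1) a w * b w = a n * (\sum_(w < n.+1) b w)
    - \sum_(w < n) (a w.+1 - a w) * \sum_(i < w.+1) b i.
  elim: n => [|n IH]; first by rewrite !big_ord_recr !big_ord0 /=; ring.
  rewrite big_ord_recr IH [X in _ = _ - X]big_ord_recr /=.
  by rewrite (big_ord_recr n.+1) /=; ring.
rewrite E; apply: le_trans (ler_cabsB _ _) _; rewrite mulrDr; apply: lerD.
  by rewrite cabsM mulrC ler_pM ?cabs_ge0 ?HS ?HA.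
apply: le_trans (ler_cabs_sum _ _ _) _.
apply: (@le_trans _ _ (\sum_(w < T) M * d)).
  apply: ler_sum => w _; rewrite cabsM mulrC ler_pM ?cabs_ge0 ?HS ?Hd //.
  - by rewrite ltnS ltnW.
  - by rewrite ltnS.
rewrite sumr_const card_ord -[X in X <= _]mulr_natr -mulrA [d * _]mulrC.
by apply: ler_wpM2l => //; apply: ler_wpM2r => //; rewrite ler_nat.
Qed.

End AbelSummation.

Section IntervalTransform.
Variables (R : realType) (q : nat).
Hypothesis q_gt1 : (1 < q)%N.
Local Notation C := R[i].
Local Notation Z := 'Z_q.

Definition interval_hat (N L : nat) (u : Z) : C :=
  \sum_(n < L) psi R (- u * (N + n)%:R).

(** The two endpoints of the interval enter through linear phases only, which a Weyl
    sum absorbs; the remaining weight [1 / (1 - psi (- u))] varies slowly with [u]. *)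
Lemma interval_hat_geometric (N L : nat) (u : Z) :
  (1 - psi R (- u)) * interval_hat N L u =
  psi R (- u * N%:R) - psi R (- u * (N + L)%:R).
Proof.
rewrite /interval_hat; elim: L => [|L IH]; first by rewrite big_ord0 mulr0 addn0 subrr.
rewrite big_ord_recr /= mulrDr IH mulrBl mul1r -psiD //.
have -> : - u + - u * (N + L)%:R = - u * (N + L.+1)%:R.
  by rewrite addnS -(natr1 (N + L)); ring.
by ring.
Qed.

Lemma cabs_1BpsiN (u : Z) : cabs (1 - psi R (- u)) = cabs (1 - psi R u).
Proof. by rewrite psiN // -cabs_conj rmorphB rmorph1; congr (cabs (_ - _)); apply: conjcK. Qed.

Lemma cabs_1Bpsi_gt0 (u : Z) : u != 0 -> 0 < cabs (1 - psi R u).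
Proof.
move=> u0; rewrite lt_def cabs_ge0 andbT cabs_eq0 subr_eq0 eq_sym.
by apply: contra u0 => /eqP/(psi_eq1 q_gt1) ->.
Qed.

Lemma interval_hat_le (N L : nat) (u : Z) : cabs (interval_hat N L u) <= L%:R.
Proof.
apply: le_trans (ler_cabs_sum _ _ _) _.
by under eq_bigr do rewrite cabs_psi; rewrite sumr_const card_ord.
Qed.

Lemma interval_hat_decay (N L : nat) (u : Z) : u != 0 ->
  cabs (interval_hat N L u) <= 2 * (cabs (1 - psi R u))^-1.
Proof.
move=> u0; rewrite ler_pdivlMr ?cabs_1Bpsi_gt0 //.
rewrite -cabs_1BpsiN -cabsM mulrC interval_hat_geometric.
by apply: le_trans (ler_cabsB _ _) _; rewrite !cabs_psi; lra.
Qed.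

End IntervalTransform.

Section BlockSum.
Variables (R : realType) (p kap r T J : nat) (B : R).
Hypotheses (p_pr : prime p) (p_odd : odd p) (kap_gt0 : (0 < kap)%N).
Local Notation q := (p ^ kap)%N.
Local Notation Z := 'Z_(p ^ kap).
Local Notation pr := (p%:R : Z).
Local Notation U := (T * p ^ r)%N.
Hypotheses (T_gt0 : (0 < T)%N) (r_gt0 : (0 < r)%N) (r6 : (kap <= r * 6)%N)
  (qJ : (q = J * U)%N).
Hypothesis phase_bound : forall (th b c0 c1 : Z) (n : nat),
  th \is a GRing.unit -> b \is a GRing.unit -> (n <= T)%N ->
  cabs (\sum_(w < n) psi R (th * sqrt_trunc (pr ^+ r * b * w%:R)
                             + (c0 + c1 * w%:R))) <= B.
Let q_gt1 := ppow_gt1 p_pr kap_gt0.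
Let p0 : (0 < p)%N := prime_gt0 p_pr.

(** Bounds [1 / |1 - psi u|] on the block of [U] consecutive values of [u] that starts at
    [j U]; the last block has index [J - 1]. *)
Definition block_weight (j : nat) : R :=
  q%:R / (2 * U%:R) * (j%:R^-1 + (J.-1 - j)%:R^-1).

(** On the class [u = u0 + p^r w] the Kloosterman sums share their stationary points,
    each contributing a quintic phase in [w]; the weight varies by at most a constant
    factor on a block, so Abel summation costs only a constant. *)
Lemma block_sum (N L h j i : nat) (v : Z) :
  (kap <= 2 * h)%N -> (0 < h < kap)%N -> (0 < j)%N -> (j < J.-1)%N ->
  (i < p ^ r)%N -> ~~ (p %| j * U + i)%N ->
  cabs (\sum_(w < T) interval_hat R N L ((j * U + (w * p ^ r + i))%:R : Z)
                      * kloosterman R ((j * U + (w * p ^ r + i))%:R : Z) v)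
  <= (2 * p ^ h)%:R * (18 * B * block_weight j).
Proof.
move=> kh /andP[h0 hk] j0 jJ ir nd.
have U0 : (0 < U)%N by rewrite muln_gt0 T_gt0 expn_gt0 p0.
have B0 : 0 <= B.
  by have := phase_bound 0 0 (unitr1 _) (unitr1 _) (leq0n T); rewrite big_ord0 cabs0.
set al := block_weight j.
pose nu (w : nat) := (j * U + (w * p ^ r + i))%N.
have nuB w : (w < T)%N -> (j * U <= nu w < j.+1 * U)%N.
  move=> wT; rewrite /nu leq_addr mulSn addnC ltn_add2r.
  by apply: (@leq_trans (w.+1 * p ^ r)); rewrite ?leq_mul2r ?wT ?orbT // mulSn addnC ltn_add2r.
pose u0 : Z := (j * U + i)%:R.
have uu0 : u0 \is a GRing.unit by rewrite unit_nat.
pose b : Z := (4%:R * u0)^-1.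
have u4 : (4%:R * u0 : Z) \is a GRing.unit.
  rewrite unitrM uu0 andbT -[4%:R]/((2 * 2)%:R) natrM unitrM.
  by rewrite unit2.
have ub : b \is a GRing.unit by rewrite unitrV.
pose V (w : nat) : Z := (nu w)%:R.
have nuE w : (V w) = u0 + pr ^+ r * w%:R.
  by rewrite /V /nu /u0 addnA addnAC [(w * _)%N]mulnC natrD natrM natrX.
pose c (w : nat) : Z := sqrt_trunc (pr ^+ r * b * w%:R).
have uE w : (V w) = u0 * c w ^+ 2.
  rewrite /c sqrt_trunc_sqr; last first.
    rewrite !exprMn -exprM.
    have /eqP -> : pr ^+ (r * 6) == 0 by rewrite ppow_eq0.
    by rewrite !mul0r.
  have E : 4%:R * u0 * b = 1 by rewrite mulrV.
  have -> : u0 * (1 + 4%:R * (pr ^+ r * b * w%:R)) =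
    u0 + pr ^+ r * w%:R * (4%:R * u0 * b) by ring.
  by rewrite E mulr1 nuE.
have uc w : c w \is a GRing.unit.
  rewrite /c /sqrt_trunc.
  set z := _ * w%:R; have -> : 1 + 2%:R * z - 2%:R * z ^+ 2 + 4%:R * z ^+ 3 - 10%:R * z ^+ 4
      + 28%:R * z ^+ 5 = 1 + pr ^+ r * (b * w%:R * (2%:R - 2%:R * z + 4%:R * z ^+ 2
       - 10%:R * z ^+ 3 + 28%:R * z ^+ 4)).
    by rewrite /z; ring.
  exact: unit_1D_ppow.
have al0 : 0 <= al.
  by rewrite /al /block_weight mulr_ge0 ?addr_ge0 ?invr_ge0 ?divr_ge0 ?mulr_ge0 ?ler0n.
have nu_dist w : (w < T)%N -> (cabs (1 - psi R (- (V w))))^-1 <= al.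
  move=> wT; have /andP[n1 n2] := nuB w wT.
  have nq : (nu w < q)%N.
    by rewrite qJ; apply: leq_trans n2 _; rewrite leq_mul2r; apply/orP; right; move: jJ; clear; lia.
  rewrite cabs_1BpsiN //.
  have : (0 < nu w < q)%N by rewrite nq andbT (leq_trans _ n1) // muln_gt0 j0.
  move/(psi_dist_nat R q_gt1)/le_trans; apply.
  have -> : al = q%:R / 2 * ((j * U)%:R^-1 + ((J.-1 - j) * U)%:R^-1).
    by rewrite /al /block_weight (natrM R j) (natrM R (J.-1 - j)) !invfM; ring.
  have inv_le k l : (0 < k)%N -> (k <= l)%N -> (l%:R : R)^-1 <= k%:R^-1.
    move=> k0 kl; rewrite lef_pV2 ?ler_nat // posrE ltr0n //.
    exact: leq_trans k0 kl.
  apply: ler_wpM2l; first by rewrite divr_ge0 ?ler0n.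
  apply: lerD; apply: inv_le => //.
  - by rewrite muln_gt0 j0.
  - by rewrite muln_gt0 subn_gt0 jJ.
  rewrite leq_subRL; last exact: ltnW.
  apply: (@leq_trans (j.+1 * U + (J.-1 - j) * U)); first by rewrite leq_add2r ltnW.
  by rewrite -mulnDl qJ leq_mul2r; apply/orP; right; move: j0 jJ; clear; lia.
have nu_neq0 w : V w != 0.
  have : (V w) \is a GRing.unit by rewrite uE unitrM uu0 unitrX.
  by apply: contraTneq => ->; rewrite unitr0.
pose a (w : nat) : R[i] := (1 - psi R (- (V w)))^-1.
have a_le w : (w < T)%N -> cabs (a w) <= al by move=> wT; rewrite cabsV nu_dist.
have d_neq0 w : 1 - psi R (- (V w)) != 0.
  by rewrite -cabs_eq0 cabs_1BpsiN // gt_eqF // cabs_1Bpsi_gt0.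
have a_var w : (w.+1 < T)%N ->
    cabs (a w.+1 - a w) <= 8 * (p ^ r)%:R / q%:R * al ^+ 2.
  move=> wT.
  have E : a w.+1 - a w = psi R (- (V w)) * (psi R (- (pr ^+ r)) - 1) * (a w.+1 * a w).
    have -> : psi R (- (V w)) * (psi R (- (pr ^+ r)) - 1) =
       psi R (- (V w.+1)) - psi R (- (V w)).
      rewrite mulrBr mulr1 -psiD //; congr (psi R _ - _).
      by rewrite !nuE -(natr1 w); ring.
    by rewrite /a; field; rewrite !d_neq0.
  rewrite E !cabsM cabs_psi mul1r cabsBC cabs_1BpsiN // expr2.
  apply: ler_pM; rewrite ?cabs_ge0 ?mulr_ge0 ?cabs_ge0 //.
    by rewrite -natrX cabs_1Bpsi_le.
  by apply: ler_pM; rewrite ?cabs_ge0 // a_le // ltnW.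
pose d := 8 * (p ^ r)%:R / q%:R * al ^+ 2.
have al_U : al * (U%:R / q%:R) <= 1.
  have qn0 : q%:R != 0 :> R by rewrite pnatr_eq0 -lt0n expn_gt0 p0.
  have Un0 : U%:R != 0 :> R by rewrite pnatr_eq0 -lt0n.
  rewrite /al /block_weight.
  have cancel_qU (Q W x y : R) : Q != 0 -> W != 0 ->
      Q / (2 * W) * (x + y) * (W / Q) = (x + y) / 2.
    by move=> Q0 W0; field; rewrite Q0 W0.
  rewrite cancel_qU //.
  have I1 k : (0 < k)%N -> (k%:R : R)^-1 <= 1.
    by move=> k0; rewrite invf_le1 ?ltr0n // ler1n.
  have := I1 _ j0; have := I1 (J.-1 - j)%N; rewrite subn_gt0 => /(_ jJ); lra.
have Td : al + T%:R * d <= 9 * al.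
  have -> : T%:R * d = 8 * al * (al * (U%:R / q%:R)).
    by rewrite /d natrM; ring.
  by nra.
(* the two endpoints of the interval each contribute one quintic phase *)
have half (th : Z) (M : nat) : th \is a GRing.unit ->
    cabs (\sum_(w < T) a w * psi R (c w * th - (V w) * M%:R)) <= 9 * B * al.
  move=> uth.
  have S n : (n <= T)%N ->
      cabs (\sum_(w < n) psi R (c w * th - (V w) * M%:R)) <= B.
    move=> nT; have := phase_bound (- u0 * M%:R) (- pr ^+ r * M%:R) uth ub nT.
    congr (cabs _ <= _); apply: eq_bigr => w _; congr (psi R _).
    by rewrite nuE /c; ring.
  have d0 : 0 <= d by rewrite mulr_ge0 ?sqr_ge0 // divr_ge0 ?mulr_ge0 ?ler0n.
  have H := @abel_summation R a (fun w => psi R (c w * th - V w * M%:R))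
    B al d T al0 d0 S a_le a_var.
  apply: (le_trans H).
  apply: le_trans (ler_wpM2l B0 Td) _; lra.
have one (x : Z) : x \in stationary h u0 v ->
  cabs (\sum_(w < T) interval_hat R N L (V w) * psi R (c w * (u0 * x + v * x^-1)))
    <= 18 * B * al.
  move=> /(stationary_phase_unit p_pr p_odd kap_gt0 hk uu0) uth.
  set th := _ + _ in uth *.
  have -> : \sum_(w < T) interval_hat R N L (V w) * psi R (c w * th) =
     \sum_(w < T) a w * psi R (c w * th - (V w) * N%:R) -
     \sum_(w < T) a w * psi R (c w * th - (V w) * (N + L)%:R).
    rewrite -sumrB; apply: eq_bigr => w _.
    have split_phase M : psi R (c w * th - V w * M%:R) =
        psi R (c w * th) * psi R (- V w * M%:R) by rewrite -psiD // mulNr.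
    rewrite !split_phase -!mulrBr -interval_hat_geometric // /a.
    by field; exact: d_neq0.
  apply: le_trans (ler_cabsB _ _) _.
  by have := half th N uth; have := half th (N + L)%N uth; lra.
rewrite -/nu.
have -> : \sum_(w < T) interval_hat R N L (V w) * kloosterman R (V w) v
  = \sum_(x in stationary h u0 v) \sum_(w < T)
      interval_hat R N L (V w) * psi R (c w * (u0 * x + v * x^-1)).
  rewrite exchange_big /=; apply: eq_bigr => w _.
  by rewrite {2}uE (kloosterman_twist R p_pr kap_gt0 u0 v kh h0 (uc w)) mulr_sumr.
apply: le_trans (ler_cabs_sum _ _ _) _.
apply: le_trans (ler_sum _ one) _.
rewrite sumr_const -[X in X <= _]mulr_natl; apply: ler_wpM2r.
  by apply: mulr_ge0 => //; apply: mulr_ge0.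
by rewrite ler_nat; exact: card_stationary.
Qed.

Lemma sum_block_weight :
  \sum_(1 <= j < J.-1) block_weight j <= q%:R / U%:R * (kap * p)%:R.
Proof.
have U0 : (0 < U)%N by rewrite muln_gt0 T_gt0 expn_gt0 p0.
rewrite -mulr_sumr big_split /=.
have -> : \sum_(1 <= j < J.-1) ((J.-1 - j)%:R^-1 : R) = \sum_(1 <= j < J.-1) j%:R^-1.
  rewrite big_nat_rev /=; apply: eq_big_nat => j /andP[j0 jJ].
  by congr (_%:R^-1); move: j0 jJ; clear; lia.
have H : \sum_(1 <= j < J.-1) (j%:R^-1 : R) <= (kap * p)%:R.
  apply: le_trans (harmonic_ppow R p_pr kap).
  have JJ : (J.-1 <= p ^ kap)%N.
    by apply: (leq_trans (leq_pred _)); rewrite qJ leq_pmulr.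
  have [J1|J1] := leqP J.-1 1.
    by rewrite big_geq // sumr_ge0 // => j _; rewrite invr_ge0 ler0n.
  rewrite [X in _ <= X](@big_cat_nat _ _ _ J.-1) ?(ltnW J1) //= lerDl.
  by rewrite sumr_ge0 // => j _; rewrite invr_ge0 ler0n.
have cancel2 (Q W x : R) : Q / (2 * W) * (x + x) = Q / W * x.
  by rewrite invfM; move: (W^-1) => y; field.
by rewrite cancel2; apply: ler_wpM2l => //; rewrite divr_ge0 ?ler0n.
Qed.

End BlockSum.

Lemma sum_nat_mul_split (V : nmodType) (a b : nat) (F : nat -> V) :
  \sum_(0 <= n < a * b) F n = \sum_(j < a) \sum_(i < b) F (j * b + i)%N.
Proof.
rewrite big_nat_mul big_mkord; apply: eq_bigr => j _.
rewrite -{1}[(j * b)%N]add0n big_addn mulSn addnK big_mkord.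
by apply: eq_bigr => i _; rewrite addnC.
Qed.

(** * Correlation of Kloosterman sums with an interval *)

Section CorrelationBounds.
Variables (R : realType) (p kap h : nat).
Hypotheses (p_pr : prime p) (p_odd : odd p) (kap_gt0 : (0 < kap)%N).
Hypotheses (h_ge : (kap <= 2 * h)%N) (h_lt : (0 < h < kap)%N).
Local Notation q := (p ^ kap)%N.
Local Notation Z := 'Z_(p ^ kap).
Local Notation pr := (p%:R : Z).
Let q_gt1 := ppow_gt1 p_pr kap_gt0.
Let p0 : (0 < p)%N := prime_gt0 p_pr.

Lemma kloosterman_le (u v : Z) : u \is a GRing.unit ->
  cabs (kloosterman R u v) <= (2 * p ^ h)%:R.
Proof.
move=> uu; have /andP[h0 hk] := h_lt.
rewrite (kloosterman_stationary R p_pr kap_gt0 u v h_ge h0).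
apply: le_trans (ler_cabs_sum _ _ _) _.
under eq_bigr do rewrite cabs_psi.
rewrite sumr_const ler_nat; exact: card_stationary.
Qed.

Lemma unit_neq0 (u : Z) : u \is a GRing.unit -> u != 0.
Proof. by apply: contraTneq => ->; rewrite unitr0. Qed.

Lemma interval_hat_l1 (N L : nat) :
  \sum_(u : Z | u \is a GRing.unit) cabs (interval_hat R N L u)
  <= 2 * (q%:R * (kap * p)%:R).
Proof.
apply: (@le_trans _ _ (\sum_(u : Z | u != 0) 2 * (cabs (1 - psi R u))^-1)).
  rewrite big_mkcond [X in _ <= X]big_mkcond /=; apply: ler_sum => u _.
  case: ifP => [/unit_neq0 u0|_]; first by rewrite u0 interval_hat_decay.
  by case: ifP => // _; rewrite mulr_ge0 // invr_ge0 cabs_ge0.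
by rewrite -mulr_sumr ler_pM2l // sum_psi_dist_neq0.
Qed.

(** The inner sum that remains after completing both sides of a box; all the saving
    beyond square-root cancellation comes from here. *)
Definition correlation (N L : nat) (v : Z) : R[i] :=
  \sum_(u : Z | u \is a GRing.unit) interval_hat R N L u * kloosterman R u v.

Lemma correlation_trivial (N L : nat) (v : Z) :
  cabs (correlation N L v) <= 2 * (q%:R * (kap * p)%:R) * (2 * p ^ h)%:R.
Proof.
apply: le_trans (ler_cabs_sum _ _ _) _.
apply: (@le_trans _ _ (\sum_(u : Z | u \is a GRing.unit)
    cabs (interval_hat R N L u) * (2 * p ^ h)%:R)).
  by apply: ler_sum => u uu; rewrite cabsM ler_wpM2l ?cabs_ge0 ?kloosterman_le.
by rewrite -mulr_suml ler_wpM2r ?ler0n // interval_hat_l1.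
Qed.

(** The blocks at both ends, where the Fourier transform of the interval does not decay,
    are short enough to be bounded trivially; they give the term with [L]. *)
Lemma correlation_blocks (r T J N L : nat) (B : R) (v : Z) :
  (0 < T)%N -> (0 < r)%N -> (kap <= r * 6)%N -> (q = J * (T * p ^ r))%N ->
  (forall (th b c0 c1 : Z) (n : nat),
    th \is a GRing.unit -> b \is a GRing.unit -> (n <= T)%N ->
    cabs (\sum_(w < n) psi R (th * sqrt_trunc (pr ^+ r * b * w%:R)
                             + (c0 + c1 * w%:R))) <= B) ->
  cabs (correlation N L v) <=
    (2 * p ^ h)%:R * (2 * (T * p ^ r)%:R * L%:R
                      + 18 * B / T%:R * q%:R * (kap * p)%:R).
Proof.
move=> T0 r0 r6 qJ HB.
set U := (T * p ^ r)%N in qJ *.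
have B0 : 0 <= B.
  by have := HB 1 1 0 0 0%N (unitr1 _) (unitr1 _) (leq0n T); rewrite big_ord0 cabs0.
have J0 : (0 < J)%N.
  by rewrite lt0n; apply/eqP => J0; move: q_gt1; rewrite qJ J0.
pose G (n : nat) : R[i] :=
  if ~~ (p %| n)%N then interval_hat R N L (n%:R : Z) * kloosterman R (n%:R : Z) v else 0.
have -> : correlation N L v = \sum_(j < J) \sum_(y < U) G (j * U + y)%N.
  rewrite /correlation big_mkcond sum_Zq // -sum_nat_mul_split -qJ.
  by apply: eq_bigr => n _; rewrite unit_nat.
have G_le n : cabs (G n) <= L%:R * (2 * p ^ h)%:R.
  rewrite /G; case: ifP => nd; last by rewrite cabs0 mulr_ge0 ?ler0n.
  by rewrite cabsM ler_pM ?cabs_ge0 ?interval_hat_le ?kloosterman_le ?unit_nat.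
set P := (2 * p ^ h)%:R : R.
have P0 : 0 <= P by rewrite ler0n.
have trivial_block j : cabs (\sum_(y < U) G (j * U + y)%N) <= P * (U%:R * L%:R).
  apply: le_trans (ler_cabs_sum _ _ _) _.
  apply: le_trans (ler_sum _ (fun y _ => G_le _)) _.
  by rewrite sumr_const card_ord -[X in X <= _]mulr_natl /P; lra.
pose W := block_weight R p kap r T J.
have middle_block j : (0 < j)%N -> (j < J.-1)%N ->
    cabs (\sum_(y < U) G (j * U + y)%N) <= P * ((p ^ r)%:R * (18 * B) * W j).
  move=> j0 jJ.
  rewrite -(big_mkord xpredT (fun y => G (j * U + y)%N)) sum_nat_mul_split exchange_big /=.
  apply: le_trans (ler_cabs_sum _ _ _) _.
  apply: (@le_trans _ _ (\sum_(i < p ^ r) P * (18 * B * W j))); last first.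
    by rewrite sumr_const card_ord -[X in X <= _]mulr_natl; lra.
  have W0 : 0 <= W j.
    by rewrite /W /block_weight mulr_ge0 ?addr_ge0 ?invr_ge0 ?divr_ge0 ?mulr_ge0 ?ler0n.
  apply: ler_sum => i _.
  have dvE w : (p %| j * U + (w * p ^ r + i))%N = (p %| j * U + i)%N.
    by rewrite addnCA dvdn_addr // dvdn_mull // -{1}(expn1 p) dvdn_exp2l.
  have [dv|nd] := boolP (p %| j * U + i)%N.
    rewrite big1 ?cabs0 => [|w _]; first by rewrite mulr_ge0 // mulr_ge0 // mulr_ge0.
    by rewrite /G dvE dv.
  have -> : \sum_(w < T) G (j * U + (w * p ^ r + i))%N =
     \sum_(w < T) interval_hat R N L ((j * U + (w * p ^ r + i))%:R : Z)
                      * kloosterman R ((j * U + (w * p ^ r + i))%:R : Z) v.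
    by apply: eq_bigr => w _; rewrite /G dvE nd.
  exact: block_sum.
apply: le_trans (ler_cabs_sum _ _ _) _.
pose mid (j : nat) := if (0 < j < J.-1)%N then P * ((p ^ r)%:R * (18 * B) * W j) else 0.
apply: (@le_trans _ _ (\sum_(j < J) (((j == 0%N :> nat) + (j == J.-1 :> nat))%N%:R * (P * (U%:R * L%:R)) + mid j))).
  apply: ler_sum => j _; have jJ : (j <= J.-1)%N by rewrite -ltnS prednK.
  have [j0|j0] := posnP j.
    apply: le_trans (trivial_block j) _.
    rewrite /mid j0 /= addr0 natrD mulrDl mul1r lerDl.
    by rewrite !mulr_ge0 ?ler0n.
  have [jm|jm] := ltnP j J.-1.
    rewrite /mid j0 jm /=; apply: le_trans (middle_block j j0 jm) _.
    by rewrite lerDr !mulr_ge0 ?ler0n.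
  have -> : (j = J.-1 :> nat) by apply/eqP; rewrite eqn_leq jJ.
  apply: le_trans (trivial_block _) _.
  rewrite /mid eqxx ltnn andbF addr0 natrD mulrDl mul1r lerDr.
  by rewrite !mulr_ge0 ?ler0n.
have delta1 k : (k < J)%N -> \sum_(j < J) ((j == k :> nat)%N%:R : R) = 1.
  move=> kJ; rewrite (bigD1 (Ordinal kJ)) //= eqxx big1 ?addr0 // => j.
  by rewrite -val_eqE /= => /negbTE ->.
rewrite big_split /= -mulr_suml.
have -> : \sum_(j < J) (((j == 0%N :> nat) + (j == J.-1 :> nat))%N%:R : R) = 1 + 1.
  by rewrite (eq_bigr _ (fun j _ => natrD _ _ _)) big_split /= !delta1 ?prednK.
have -> : \sum_(j < J) mid j = P * ((p ^ r)%:R * (18 * B)) * \sum_(1 <= j < J.-1) W j.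
  rewrite mulr_sumr big_geq_mkord (@big_ord_widen_cond _ _ _ J.-1 J (fun j => 0 < j)%N
    (fun j => P * ((p ^ r)%:R * (18 * B)) * W j)) ?leq_pred // [RHS]big_mkcond /=.
  by apply: eq_bigr => j _; rewrite /mid; case: ifP => // _; rewrite !mulrA.
have HW := sum_block_weight R p_pr T0 qJ.
have c0 : 0 <= P * ((p ^ r)%:R * (18 * B)) by rewrite !mulr_ge0.
apply: le_trans (lerD (lexx _) (ler_wpM2l c0 HW)) _.
have pn0 : (p ^ r)%:R != 0 :> R by rewrite pnatr_eq0 -lt0n expn_gt0 p0.
have Tn0 : T%:R != 0 :> R by rewrite pnatr_eq0 -lt0n.
rewrite /U (natrM R T).
move: (T%:R) ((p ^ r)%:R) Tn0 pn0 => t x tn0 xn0.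
rewrite le_eqVlt; apply/orP; left; apply/eqP; field; by rewrite tn0 xn0.
Qed.

End CorrelationBounds.

(** * Point counts in boxes *)

Definition box_count (q a N L M H : nat) : nat :=
  (\sum_(n < L) \sum_(k < H) ((N + n) * (M + k) == a %[mod q]))%N.

Section BoxFourier.
Variables (R : realType) (p kap h : nat).
Hypotheses (p_pr : prime p) (p_odd : odd p) (kap_gt0 : (0 < kap)%N).
Hypotheses (h_ge : (kap <= 2 * h)%N) (h_lt : (0 < h < kap)%N).
Local Notation q := (p ^ kap)%N.
Local Notation Z := 'Z_(p ^ kap).
Local Notation pr := (p%:R : Z).
Local Notation C := R[i].
Let q_gt1 := ppow_gt1 p_pr kap_gt0.
Let p0 : (0 < p)%N := prime_gt0 p_pr.

(** The nonunits form the ideal generated by [p], so the sum is invariant under adding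
    [p] to the variable. *)
Lemma sum_nonunit_psi (y : Z) :
  \sum_(u : Z | u \isn't a GRing.unit) psi R (u * y) =
  if pr * y == 0 then (p ^ kap.-1)%:R else 0.
Proof.
have [py|py] := eqVneq (pr * y) 0.
  rewrite (eq_bigr (fun=> 1)) => [|u]; last first.
    rewrite unit_ppowE // negbK => /dvdnP[m um].
    by rewrite (Zq_nat u) um natrM -mulrA py mulr0 psi0.
  rewrite sumr_const; congr (_%:R).
  rewrite -(card_annihilator p_pr kap_gt0 (leq_pred kap)).
  by apply: eq_card => u; rewrite inE -nonunit_ppowE.
set s := \sum_(_ | _) _.
have shiftE (u : Z) : (pr + u \isn't a GRing.unit) = (u \isn't a GRing.unit).
  rewrite !nonunit_ppowE // mulrDr -exprSr prednK //.
  have /eqP -> : pr ^+ kap == 0 by rewrite ppow_eq0.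
  by rewrite add0r.
have E : psi R (pr * y) * s = s.
  rewrite /s mulr_sumr [RHS](reindex_inj (addrI pr)) /=.
  by apply: eq_big => [u|u _]; [rewrite shiftE|rewrite mulrDl psiD].
have : (psi R (pr * y) - 1) * s = 0 by rewrite mulrBl E mul1r subrr.
move/eqP; rewrite mulf_eq0 subr_eq0 => /orP[/eqP/(psi_eq1 q_gt1) H|/eqP//].
by rewrite H eqxx in py.
Qed.

Lemma exchange_big2 (V : nmodType) (I1 I2 I3 : finType) (P1 : pred I1)
    (P2 : pred I2) (P3 : pred I3) (F : I1 -> I2 -> I3 -> V) :
  \sum_(u | P1 u) \sum_(v | P2 v) \sum_(n | P3 n) F u v n =
  \sum_(n | P3 n) \sum_(u | P1 u) \sum_(v | P2 v) F u v n.
Proof.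
rewrite exchange_big /= [RHS](eq_bigr _ (fun n _ => exchange_big _ _ _ _ _ _)) /=.
by rewrite [RHS]exchange_big /=; apply: eq_bigr => v _; rewrite exchange_big.
Qed.

(** Used twice, for all frequencies and for the nonunits: the sum over [u] and [v]
    detects [x = n] and [a / x = m] in the sense measured by [chi]. *)
Lemma box_fourier (P : pred Z) (chi : Z -> C) (a : Z) (N L M H : nat) :
  (forall y, \sum_(u : Z | P u) psi R (u * y) = chi y) ->
  \sum_(u : Z | P u) \sum_(v : Z | P v) interval_hat R N L u *
      (interval_hat R M H v * kloosterman R u (v * a)) =
  \sum_(n < L) \sum_(k < H) \sum_(x : Z | x \is a GRing.unit)
     chi (x - (N + n)%:R) * chi (a * x^-1 - (M + k)%:R).
Proof.
move=> Hchi.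
transitivity (\sum_(u : Z | P u) \sum_(v : Z | P v) \sum_(n < L) \sum_(k < H)
   \sum_(x : Z | x \is a GRing.unit)
     psi R (u * (x - (N + n)%:R)) * psi R (v * (a * x^-1 - (M + k)%:R))).
  apply: eq_bigr => u _; apply: eq_bigr => v _.
  rewrite /interval_hat mulr_suml; apply: eq_bigr => n _.
  rewrite mulr_suml mulr_sumr; apply: eq_bigr => k _.
  rewrite /kloosterman !mulr_sumr; apply: eq_bigr => x _.
  by rewrite -!psiD //; congr psi; ring.
rewrite exchange_big2; apply: eq_bigr => n _.
rewrite exchange_big2; apply: eq_bigr => k _.
rewrite exchange_big2; apply: eq_bigr => x _.
by rewrite -!Hchi big_distrlr.
Qed.

Lemma Zq_nat_eq (x y : nat) : (x%:R == y%:R :> Z) = (x == y %[mod q]).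
Proof. by rewrite -val_eqE /= !val_Zp_nat. Qed.

Lemma ppow_nat_eq (x y : nat) :
  (pr * (x%:R - y%:R) == 0) = (x == y %[mod p ^ kap.-1]).
Proof.
rewrite mulrBr subr_eq0 -!natrM Zq_nat_eq -{1 2}(prednK kap_gt0) expnS.
by rewrite -!muln_modr eqn_pmul2l.
Qed.

(** All frequencies together count the box modulo [p^kap].  Pairs with exactly one unit
    contribute nothing, and the pairs of nonunits count solutions modulo [p^(kap - 1)],
    each of which lifts to [p] units [x]. *)
Lemma box_count_fourier (a N L M H : nat) : ~~ (p %| a)%N -> (1 < kap)%N ->
  \sum_(v : Z | v \is a GRing.unit)
    interval_hat R M H v * correlation R N L (v * a%:R) =
  q%:R ^+ 2 * ((box_count q a N L M H)%:R
               - (box_count (p ^ kap.-1) a N L M H)%:R / p%:R).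
Proof.
move=> pa kap1.
have ua : (a%:R : Z) \is a GRing.unit by rewrite unit_nat.
have /andP[h0 hk] := h_lt.
pose F (u v : Z) := interval_hat R N L u *
   (interval_hat R M H v * kloosterman R u (v * a%:R)).
have mixed (u v : Z) : (u \is a GRing.unit) != (v \is a GRing.unit) -> F u v = 0.
  move=> uv; rewrite /F (kloosterman_eq0 R p_pr p_odd kap_gt0 h_ge h_lt) ?mulr0 //.
  by rewrite unitrMl.
have all_split : \sum_(u : Z) \sum_(v : Z) F u v =
    \sum_(u : Z | u \is a GRing.unit) \sum_(v : Z | v \is a GRing.unit) F u v +
    \sum_(u : Z | u \isn't a GRing.unit) \sum_(v : Z | v \isn't a GRing.unit) F u v.
  rewrite (bigID (fun u : Z => u \is a GRing.unit)) /=; congr (_ + _).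
    apply: eq_bigr => u uu; rewrite (bigID (fun v : Z => v \is a GRing.unit)) /=.
    by rewrite [X in _ + X]big1 ?addr0 // => v nv; rewrite mixed // uu (negbTE nv).
  apply: eq_bigr => u nu; rewrite (bigID (fun v : Z => v \is a GRing.unit)) /=.
  by rewrite [X in X + _]big1 ?add0r // => v uv; rewrite mixed // uv (negbTE nu).
have full : \sum_(u : Z) \sum_(v : Z) F u v = q%:R ^+ 2 * (box_count q a N L M H)%:R.
  rewrite (@box_fourier xpredT (fun y => if y == 0 then q%:R else 0)); last first.
    by move=> y; exact: psi_orthogonal.
  rewrite /box_count natr_sum mulr_sumr; apply: eq_bigr => n _.
  rewrite natr_sum mulr_sumr; apply: eq_bigr => k _.
  rewrite -Zq_nat_eq natrM.
  set nz : Z := (N + n)%:R; set kz : Z := (M + k)%:R.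
  have [nk|nk] := eqVneq (nz * kz) a%:R; last first.
    rewrite mulr0 big1 // => x ux; rewrite !subr_eq0.
    have [xn|_] := eqVneq x nz; last by rewrite mul0r.
    case: eqP => [E|_]; last by rewrite mulr0.
    move/eqP: nk; case; rewrite -xn -E mulrC divrK //.
  have un : nz \is a GRing.unit by move: ua; rewrite -nk unitrM => /andP[].
  rewrite (bigD1 nz) //= subrr eqxx big1 ?addr0 => [|x /andP[_ xn]]; last first.
    by rewrite subr_eq0 (negbTE xn) mul0r.
  have -> : a%:R * nz^-1 - kz = 0 by rewrite -nk mulrAC divrr // mul1r subrr.
  by rewrite eqxx mulr1 expr2.
have nonunit : \sum_(u : Z | u \isn't a GRing.unit)
     \sum_(v : Z | v \isn't a GRing.unit) F u v =
    q%:R ^+ 2 * ((box_count (p ^ kap.-1) a N L M H)%:R / p%:R).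
  rewrite (box_fourier _ _ _ _ _ sum_nonunit_psi).
  rewrite mulrA mulrAC /box_count natr_sum mulr_sumr; apply: eq_bigr => n _.
  rewrite natr_sum mulr_sumr; apply: eq_bigr => k _.
  rewrite -ppow_nat_eq natrM.
  set nz : Z := (N + n)%:R; set kz : Z := (M + k)%:R.
  have prN (x : Z) : pr * (x - nz) = 0 -> x \is a GRing.unit ->
       (pr * (a%:R * x^-1 - kz) == 0) = (pr * (nz * kz - a%:R) == 0).
    move=> E ux; rewrite -(@ppow_mul_unit_eq0 p kap 1 _ _ ux) expr1.
    have X : x^-1 * x = 1 by rewrite mulVr.
    have -> : pr * (x * (a%:R * x^-1 - kz)) = 
        pr * a%:R * (x^-1 * x) - kz * (pr * (x - nz)) - pr * nz * kz by ring.
    rewrite X E mulr0 subr0 mulr1.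
    by rewrite -(opprK (_ - _)) oppr_eq0; congr (_ == 0); ring.
  have [nk|nk] := eqVneq (pr * (nz * kz - a%:R)) 0; last first.
    rewrite mulr0 big1 // => x ux.
    case: eqP => [E|_]; last by rewrite mul0r.
    by rewrite (prN _ E ux) (negbTE nk) mulr0.
  have un : nz \is a GRing.unit.
    have : nz * kz \is a GRing.unit.
      apply: contraT => nu.
      have : (a%:R : Z) \isn't a GRing.unit; last by rewrite ua.
      have -> : (a%:R : Z) = nz * kz - (nz * kz - a%:R) by ring.
      move: nu; rewrite !nonunit_ppowE // mulrBr => /eqP ->.
      rewrite sub0r oppr_eq0; apply/eqP/(@ppow_annihilatorM p kap 1); last by rewrite expr1.
      by rewrite -ltnS prednK.
    by rewrite unitrM => /andP[].
  rewrite (bigID (fun x : Z => pr * (x - nz) == 0)) /= [X in _ + X]big1 ?addr0; last first.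
    by move=> x /andP[_ /negbTE ->]; rewrite mul0r.
  rewrite (eq_bigr (fun=> (p ^ kap.-1)%:R * (p ^ kap.-1)%:R)) => [|x /andP[ux /eqP E]]; last first.
    by rewrite E eqxx (prN _ E ux) nk eqxx.
  rewrite sumr_const.
  have -> : #|[pred x : Z | (x \is a GRing.unit) && (pr * (x - nz) == 0)]| = p.
    rewrite -[RHS]expn1 -(card_annihilator p_pr kap_gt0 kap_gt0).
    rewrite -(card_imset _ (addrI nz)); apply: eq_card => x; rewrite !inE.
    apply/andP/imsetP => [[_ E]|[y]].
      by exists (x - nz); [rewrite inE expr1|ring].
    rewrite inE expr1 => /eqP E ->.
    have -> : nz + y - nz = y by ring.
    rewrite E eqxx; split=> //; apply: contraT => nu.
    have : nz \isn't a GRing.unit; last by rewrite un.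
    have -> : nz = (nz + y) - y by ring.
    move: nu; rewrite !nonunit_ppowE // mulrBr => /eqP ->.
    rewrite sub0r oppr_eq0; apply/eqP/(@ppow_annihilatorM p kap 1); last by rewrite expr1.
    by rewrite -ltnS prednK.
  have pn0 : p%:R != 0 :> C by rewrite pnatr_eq0 -lt0n.
  have -> : q%:R = p%:R * (p ^ kap.-1)%:R :> C by rewrite -natrM -expnS prednK.
  rewrite -[_ *+ p]mulr_natr.
  by move: ((p ^ kap.-1)%:R : C) => Q; field.
rewrite mulrBr -full -nonunit all_split addrK exchange_big /=.
apply: eq_bigr => v _; rewrite /correlation mulr_sumr; apply: eq_bigr => u _.
by rewrite /F mulrCA.
Qed.

Lemma box_count_descent (a N L M H : nat) (E : R) : ~~ (p %| a)%N -> (1 < kap)%N ->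
  (forall v : Z, cabs (correlation R N L v) <= E) ->
  `|(box_count q a N L M H)%:R - (box_count (p ^ kap.-1) a N L M H)%:R / p%:R|
  <= 2 * (kap * p)%:R * E / q%:R :> R.
Proof.
move=> pa kap1 HE; set x : R := _ - _.
have q0 : 0 < q%:R :> R by rewrite ltr0n expn_gt0 p0.
have E0 : 0 <= E by apply: le_trans (HE 0); exact: cabs_ge0.
have : cabs (q%:R ^+ 2 * x%:C%C) <= 2 * (q%:R * (kap * p)%:R) * E.
  have -> : x%:C%C = (box_count q a N L M H)%:R - (box_count (p ^ kap.-1) a N L M H)%:R / p%:R.
    by rewrite /x rmorphB rmorphM /= fmorphV /= !rmorph_nat.
  rewrite -box_count_fourier //; apply: le_trans (ler_cabs_sum _ _ _) _.
  apply: (@le_trans _ _ (\sum_(v : Z | v \is a GRing.unit) cabs (interval_hat R M H v) * E)).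
    by apply: ler_sum => v _; rewrite cabsM ler_wpM2l ?cabs_ge0.
  by rewrite -mulr_suml ler_wpM2r // interval_hat_l1.
rewrite cabsM cabs_real expr2 cabsM cabs_nat => H'.
rewrite ler_pdivlMr // -(ler_pM2l q0); nra.
Qed.

End BoxFourier.

(** * Comparing residue classes in a box *)

Section ResidueCounts.
Local Open Scope nat_scope.

Definition row_count (q a x M H : nat) : nat :=
  \sum_(k < H) (x * (M + k) == a %[mod q]).

Lemma window_count (q c M : nat) : 0 < q ->
  \sum_(k < q) (M + k == c %[mod q]) = 1.
Proof.
move=> q0; elim: M => [|M IH].
  have cq : c %% q < q by rewrite ltn_mod.
  rewrite (bigD1 (Ordinal cq)) //= add0n modn_mod eqxx big1 // => k.
  by rewrite -val_eqE /= add0n (modn_small (ltn_ord k)) => /negbTE ->.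
case: q q0 IH => // q _ IH.
rewrite big_ord_recr /=; rewrite big_ord_recl /= addn0 in IH.
rewrite -[RHS]IH addnC; congr (_ + _).
  by congr (nat_of_bool (_ == _)); rewrite addSnnS modnDr.
by apply: eq_bigr => k _; rewrite addSnnS.
Qed.

Lemma residue_count (q c M H : nat) : 0 < q ->
  H %/ q <= \sum_(k < H) (M + k == c %[mod q]) <= (H %/ q).+1.
Proof.
move=> q0; have split_at (M' A B : nat) : \sum_(k < A + B) (M' + k == c %[mod q]) =
    \sum_(k < A) (M' + k == c %[mod q]) + \sum_(k < B) (M' + A + k == c %[mod q]).
  by rewrite big_split_ord /=; congr (_ + _); apply: eq_bigr => k _; rewrite addnA.
have split1 := split_at M.
have full d : \sum_(k < d * q) (M + k == c %[mod q]) = d.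
  elim: d => [|d IH]; first by rewrite mul0n big_ord0.
  by rewrite mulSnr split1 IH window_count // addn1.
have E := split1 (H %/ q * q) (H %% q); rewrite full -divn_eq in E.
rewrite E leq_addr /= -[X in _ <= X]addn1 leq_add2l.
have rq : H %% q <= q by rewrite ltnW // ltn_mod.
rewrite -(window_count c (M + H %/ q * q) q0).
have E' := split_at (M + H %/ q * q) (H %% q) (q - H %% q); rewrite subnKC // in E'.
by rewrite E' leq_addr.
Qed.

Lemma coprime_congr_dvd (q a x y : nat) : coprime a q -> x * y = a %[mod q] ->
  coprime x q.
Proof.
move=> aq E; have : coprime (x * y) q by rewrite -coprime_modl E coprime_modl.
by rewrite coprimeMl => /andP[].
Qed.

(** For [x] prime to [q] the row meets one class of an interval of integers, whose count
    is determined up to one by the length; otherwise the row is empty. *)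
Lemma row_count_diff (q a a' x M H : nat) : 1 < q ->
  coprime a q -> coprime a' q -> row_count q a x M H <= (row_count q a' x M H).+1.
Proof.
move=> q1 aq aq'; have q0 := ltnW q1.
have [xq|nxq] := boolP (coprime x q); last first.
  rewrite /row_count big1 // => k _; case: eqP => // /(coprime_congr_dvd aq).
  by rewrite (negbTE nxq).
have solve b : row_count q b x M H = \sum_(k < H) (M + k == b * x ^ (totient q).-1 %[mod q]).
  have xb : x * (b * x ^ (totient q).-1) = b %[mod q].
    rewrite mulnCA -expnS prednK ?totient_gt0 //.
    by rewrite -modnMmr Euler_exp_totient // modnMmr muln1.
  apply: eq_bigr => k _; congr nat_of_bool; rewrite -{1}xb.
  apply/eqP/eqP => [|E]; last by rewrite -modnMmr E modnMmr.
  set y := b * _ in xb *; set z := M + k => /eqP.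
  have qx : coprime q x by rewrite coprime_sym.
  case/orP: (leq_total z y) => h; [rewrite eq_sym|]; rewrite eqn_mod_dvd ?leq_mul //.
    by rewrite -mulnBr Gauss_dvdr // -eqn_mod_dvd // => /eqP.
  by rewrite -mulnBr Gauss_dvdr // -eqn_mod_dvd // => /eqP.
rewrite !solve.
have /andP[_ h1] := residue_count (a * x ^ (totient q).-1) M H q0.
have /andP[h2 _] := residue_count (a' * x ^ (totient q).-1) M H q0.
by apply: leq_trans h1 _; rewrite ltnS.
Qed.

Lemma box_count_rows (q a N L M H : nat) :
  box_count q a N L M H = \sum_(n < L) row_count q a (N + n) M H.
Proof. by []. Qed.

Lemma box_count_diff_trivial (q a a' N L M H : nat) : 1 < q ->
  coprime a q -> coprime a' q ->
  box_count q a N L M H <= box_count q a' N L M H + L.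
Proof.
move=> q1 aq aq'; rewrite !box_count_rows.
apply: (@leq_trans (\sum_(n < L) (row_count q a' (N + n) M H + 1))).
  by apply: leq_sum => n _; rewrite addn1 row_count_diff.
by rewrite big_split /= sum_nat_const card_ord muln1.
Qed.

(** Every pair of the box falls in at most one residue class. *)
Lemma sum_box_count (q N L M H : nat) : 0 < q ->
  \sum_(a < q | coprime a q) box_count q a N L M H <= L * H.
Proof.
move=> q0; rewrite /box_count exchange_big /=.
apply: (@leq_trans (\sum_(n < L) \sum_(k < H) 1)).
  apply: leq_sum => n _; rewrite exchange_big /=; apply: leq_sum => k _.
  have yq : ((N + n) * (M + k)) %% q < q by rewrite ltn_mod.
  rewrite big_mkcond (bigD1 (Ordinal yq)) //= big1 ?addn0 => [|i].
    by case: ifP => //; case: eqP.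
  rewrite -val_eqE /= eq_sym => /negbTE H1; case: ifP => // _.
  by rewrite (modn_small (ltn_ord i)) H1.
by rewrite sum_nat_const card_ord sum_nat_const card_ord muln1.
Qed.

End ResidueCounts.

Section Telescope.
Variables (R : realType) (p : nat).
Hypothesis p_pr : prime p.
Let p0 : (0 < p)%N := prime_gt0 p_pr.

(** By descent on the exponent: the main terms of the two classes differ by [1 / p] times
    the difference one level below, and at the bottom rows differ by at most one. *)
Lemma box_count_telescope (kap a a' N L M H : nat) (e : R) :
  0 <= e ->
  (forall j b, (1 < j <= kap)%N -> ~~ (p %| b)%N ->
     `|(box_count (p ^ j) b N L M H)%:R - (box_count (p ^ j.-1) b N L M H)%:R / p%:R|
       * (p ^ j)%:R <= e) ->
  (0 < kap)%N -> ~~ (p %| a)%N -> ~~ (p %| a')%N ->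
  `|(box_count (p ^ kap) a N L M H)%:R - (box_count (p ^ kap) a' N L M H)%:R|
     * (p ^ kap)%:R <= (p * L)%:R + 2 * kap%:R * e.
Proof.
move=> e0 He; elim: kap He => // kap IH He _ pa pa'.
pose B j b := (box_count (p ^ j) b N L M H)%:R : R.
rewrite -/(B kap.+1 a) -/(B kap.+1 a').
case: kap IH He => [|kap] IH He.
  have d1 (x y z : nat) : (x <= y + z)%N -> (x%:R <= y%:R + z%:R :> R).
    by rewrite -natrD ler_nat.
  have cop b : ~~ (p %| b)%N -> coprime b (p ^ 1) by rewrite expn1 coprime_sym prime_coprime.
  have p1 : (1 < p ^ 1)%N by rewrite expn1 prime_gt1.
  have h1 := d1 _ _ _ (box_count_diff_trivial N L M H p1 (cop _ pa) (cop _ pa')).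
  have h2 := d1 _ _ _ (box_count_diff_trivial N L M H p1 (cop _ pa') (cop _ pa)).
  have h : `|B 1%N a - B 1%N a'| <= L%:R by rewrite ler_norml /B; apply/andP; split; lra.
  rewrite expn1 natrM [X in X <= _]mulrC mulr1.
  apply: (@le_trans _ _ (p%:R * L%:R)); first by rewrite ler_wpM2l ?ler0n.
  by rewrite lerDl mulr_ge0.
have IH' := IH _ isT pa pa'.
have {}IH' : `|B kap.+1 a - B kap.+1 a'| * (p ^ kap.+1)%:R <= (p * L)%:R + 2 * kap.+1%:R * e.
  by apply: IH' => j b /andP[j1 j2]; apply: He; rewrite j1 leqW.
have h1 := He kap.+2 a; have h2 := He kap.+2 a'.
rewrite leqnn /= in h1 h2; have {}h1 := h1 isT pa; have {}h2 := h2 isT pa'.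
rewrite -/(B kap.+2 a) -/(B kap.+2 a') -/(B kap.+1 a) -/(B kap.+1 a') in h1 h2 *.
move: (B kap.+2 a) (B kap.+2 a') (B kap.+1 a) (B kap.+1 a') IH' h1 h2 => x x' y y' h0 h1 h2.
have P0 : 0 < (p ^ kap.+1)%:R :> R by rewrite ltr0n expn_gt0 p0.
have p0' : 0 < p%:R :> R by rewrite ltr0n.
rewrite (natrM R p L) in h0 *.
rewrite [(p ^ kap.+2)%N]expnS (natrM R p (p ^ kap.+1)) -(natr1 kap.+1) in h1 h2 *.
move: ((p ^ kap.+1)%:R) (p%:R) P0 p0' h0 h1 h2 => P t P0 t0 h0 h1 h2.
have E : x - x' = (x - y / t) + (y / t - y' / t) - (x' - y' / t) by ring.
have T1 : `|x - x'| <= `|x - y / t| + `|y - y'| / t + `|x' - y' / t|.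
  rewrite E; apply: le_trans (ler_normB _ _) _; rewrite lerD2r.
  apply: le_trans (ler_normD _ _) _; rewrite lerD2l -mulrBl normrM (gtr0_norm (_ : 0 < t^-1)) //.
  by rewrite invr_gt0.
have tP : 0 <= t * P by rewrite mulr_ge0 // ltW.
apply: le_trans (ler_wpM2r tP T1) _.
have -> : (`|x - y / t| + `|y - y'| / t + `|x' - y' / t|) * (t * P) =
  `|x - y / t| * (t * P) + `|y - y'| * P + `|x' - y' / t| * (t * P).
  by move: (`|_|) (`|_|) (`|_|) => a1 a2 a3; field; rewrite gt_eqF.
lra.
Qed.

End Telescope.

(** * The divisor sum as a count under a hyperbola *)

Section DivisorHyperbola.
Local Open Scope nat_scope.

Definition hyperbola_count (q a x : nat) : nat :=
  \sum_(1 <= d < x.+1) \sum_(1 <= m < x.+1) ((d * m <= x) && (d * m == a %[mod q])).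

Lemma sum_multiples (d x : nat) (F : nat -> nat) : 0 < d ->
  \sum_(1 <= n < x.+1) (d %| n) * F n = \sum_(1 <= m < (x %/ d).+1) F (d * m).
Proof.
move=> d0; elim: x => [|x IH]; first by rewrite div0n !big_geq.
rewrite big_nat_recr //= IH divnS //.
case dv : (d %| x.+1) => /=; last by rewrite mul0n addn0.
have E : x.+1 = d * (x %/ d).+1 by rewrite mulnC -{1}(divnK dv) divnS // dv add1n.
by rewrite mul1n add1n [RHS]big_nat_recr //= -E.
Qed.

Lemma num_divisors_sum (n x : nat) : 0 < n -> n <= x ->
  num_divisors n = \sum_(1 <= d < x.+1) (d %| n).
Proof.
move=> n0 nx; rewrite /num_divisors.
have -> : \sum_(1 <= d < x.+1) (d %| n) = size [seq d <- index_iota 1 x.+1 | d %| n].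
  by rewrite -sum1_size big_filter [RHS]big_mkcond; apply: eq_bigr => d _; case: ifP.
apply/perm_size/uniq_perm; rewrite ?divisors_uniq ?filter_uniq ?iota_uniq // => d.
rewrite mem_filter -dvdn_divisors // mem_index_iota.
case dv: (d %| n) => //=.
by rewrite (dvdn_gt0 n0 dv) ltnS (leq_trans (dvdn_leq n0 dv) nx).
Qed.

Lemma divisor_sum_hyperbola (q a x : nat) :
  \sum_(1 <= n < x.+1 | n == a %[mod q]) num_divisors n = hyperbola_count q a x.
Proof.
rewrite big_mkcond /=.
transitivity (\sum_(1 <= n < x.+1) \sum_(1 <= d < x.+1) (d %| n) * (n == a %[mod q])).
  apply: eq_big_nat => n /andP[n0 nx].
  case: ifP => _; last by rewrite big1 // => d _; rewrite muln0.
  by rewrite (num_divisors_sum n0 nx); apply: eq_bigr => d _; rewrite muln1.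
rewrite exchange_big_nat /=; apply: eq_big_nat => d /andP[d0 dx].
rewrite (sum_multiples x (fun n => (n == a %[mod q] : nat)) d0).
have dx' : (x %/ d).+1 <= x.+1 by rewrite ltnS leq_div.
rewrite [RHS](@big_cat_nat _ _ _ (x %/ d).+1) //= [X in _ + X]big_nat_cond.
rewrite [X in _ + X]big1 ?addn0 => [|m]; last first.
  by rewrite andbT => /andP[m1 _]; rewrite mulnC -leq_divRL // leqNgt m1.
apply: eq_big_nat => m /andP[_ m1].
by rewrite mulnC -leq_divRL // -ltnS m1.
Qed.

Definition hyperbola_rows (q a x S lo : nat) : nat :=
  \sum_(1 <= d < S) row_count q a d lo ((x %/ d).+1 - lo).

(** A point under the hyperbola has a coordinate below [S]: rows [d < S] are taken
    entirely, and the points with [d >= S] are read by columns. *)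
Lemma hyperbola_split (q a x S : nat) : x < S * S -> S <= x.+1 -> 0 < S ->
  hyperbola_count q a x = hyperbola_rows q a x S 1 + hyperbola_rows q a x S S.
Proof.
move=> xS Sx S0.
pose t d m : nat := (d * m <= x) && (d * m == a %[mod q]).
have tC d m : t d m = t m d by rewrite /t mulnC.
have row d lo : 0 < d -> \sum_(lo <= m < x.+1) t d m = row_count q a d lo ((x %/ d).+1 - lo).
  move=> d0; have dx : (x %/ d).+1 <= x.+1 by rewrite ltnS leq_div.
  have tE m : t d m = if m < (x %/ d).+1 then (d * m == a %[mod q] : nat) else 0.
    by rewrite /t mulnC -leq_divRL // ltnS; case: ifP.
  have [h|h] := leqP lo (x %/ d).+1; last first.
    rewrite (_ : (x %/ d).+1 - lo = 0); last by apply/eqP; rewrite subn_eq0 ltnW.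
    rewrite /row_count big_ord0 big_nat_cond big1 // => m; rewrite andbT => /andP[m1 _].
    by rewrite tE ltnNge (leq_trans (ltnW h) m1).
  rewrite (@big_cat_nat _ _ _ (x %/ d).+1) //= [X in _ + X]big_nat_cond.
  rewrite [X in _ + X]big1 ?addn0 => [|m]; last first.
    by rewrite andbT tE => /andP[m1 _]; rewrite ltnNge m1.
  rewrite -{1}[lo]add0n big_addn /row_count big_mkord; apply: eq_bigr => k _.
  by rewrite tE addnC -ltn_subRL ltn_ord.
rewrite /hyperbola_count /hyperbola_rows (@big_cat_nat _ _ _ S) //=.
congr (_ + _); first by apply: eq_big_nat => d /andP[d0 _]; rewrite -row.
rewrite exchange_big_nat /= (@big_cat_nat _ _ _ S) //= [X in _ + X]big_nat_cond.
rewrite [X in _ + X]big1 ?addn0 => [|m]; last first.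
  rewrite andbT => /andP[m1 _]; rewrite big_nat_cond big1 // => d.
  rewrite andbT => /andP[d1 _]; case: leqP => //= dm.
  by have := leq_mul d1 m1; rewrite leqNgt (leq_ltn_trans dm xS).
apply: eq_big_nat => m /andP[m0 _]; rewrite -row //.
by apply: eq_bigr => d _; rewrite [RHS]tC.
Qed.

Lemma sum_dyadic_split (V : nmodType) (Z J : nat) (F : nat -> V) :
  (\sum_(Z <= d < 2 ^ J * Z) F d = \sum_(j < J) \sum_(i < Z) \sum_(l < 2 ^ j)
     F (2 ^ j * (Z + i) + l)%N)%R.
Proof.
elim: J => [|J IH]; first by rewrite mul1n big_geq // big_ord0.
have h1 : Z <= 2 ^ J * Z by rewrite leq_pmull // expn_gt0.
have h2 : 2 ^ J * Z <= 2 ^ J.+1 * Z by rewrite leq_mul2r leq_exp2l ?leqnSn ?orbT.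
rewrite big_ord_recr /= -IH (@big_cat_nat _ _ _ _ _ _ _ _ h1 h2) /=.
congr (_ + _)%R.
have -> : 2 ^ J.+1 * Z = Z * 2 ^ J + 2 ^ J * Z by rewrite expnS mul2n -addnn mulnDl mulnC.
rewrite -{1}[2 ^ J * Z]add0n big_addn addnK sum_nat_mul_split.
apply: eq_bigr => i _; apply: eq_bigr => l _; congr F.
by rewrite mulnDr [(i * _)%N]mulnC; lia.
Qed.

End DivisorHyperbola.

(** * Dissection of the region under the hyperbola *)

Section Dissection.
Variables (R : realType) (q S Z J x : nat) (eps : R).
Hypotheses (q_gt1 : (1 < q)%N) (Z_gt0 : (0 < Z)%N) (SE : S = (2 ^ J * Z)%N).
Hypothesis box_eps : forall a a' N L M H : nat, coprime a q -> coprime a' q ->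
  (L <= S)%N ->
  (box_count q a N L M H)%:R <= (box_count q a' N L M H)%:R + eps :> R.
Local Notation phi := ((totient q)%:R : R).

Let phi_gt0 : 0 < phi. Proof. by rewrite ltr0n totient_gt0 ltnW. Qed.

Lemma sum_coprime_const (c : R) : \sum_(b < q | coprime b q) c = phi * c.
Proof.
rewrite sumr_const -[LHS]mulr_natl; congr (_%:R * _).
rewrite totient_count_coprime big_mkord -sum1_card big_mkcond /=.
apply: eq_bigr => b _; rewrite -[X in (if X then _ else _)]/(coprime b q) coprime_sym.
by case: (coprime q b).
Qed.

(** The counts of all reduced classes add up to at most the number of points of the box,
    and they differ by at most [eps]. *)
Lemma box_count_upper (a N L M H : nat) : coprime a q -> (L <= S)%N ->
  (box_count q a N L M H)%:R <= eps + (L * H)%:R / phi.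
Proof.
move=> aq LS; rewrite addrC -lerBlDr ler_pdivlMr // mulrC -sum_coprime_const.
apply: (@le_trans _ _ (\sum_(b < q | coprime b q) (box_count q b N L M H)%:R)).
  by apply: ler_sum => b bq; rewrite lerBlDr box_eps.
by rewrite -natr_sum ler_nat sum_box_count // ltnW.
Qed.

Lemma row_count_cat (a d M H H' : nat) : (H <= H')%N ->
  row_count q a d M H' = (row_count q a d M H + row_count q a d (M + H) (H' - H))%N.
Proof.
move=> HH; have E K : row_count q a d M (H + K) =
    (row_count q a d M H + row_count q a d (M + H) K)%N.
  rewrite /row_count big_split_ord /=; congr (_ + _)%N.
  by apply: eq_bigr => k _; rewrite addnA.
by rewrite -E subnKC.
Qed.

(** The part of the region under the hyperbola above a short interval of rows lies
    between two boxes, whose difference is again a box. *)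
Lemma block_rows_diff (a a' n0 len lo : nat) : coprime a q -> coprime a' q ->
  (0 < n0)%N -> (len <= S)%N -> (len * Z <= n0)%N ->
  (\sum_(l < len) row_count q a (n0 + l) lo ((x %/ (n0 + l)).+1 - lo))%N%:R
  <= (\sum_(l < len) row_count q a' (n0 + l) lo ((x %/ (n0 + l)).+1 - lo))%N%:R
     + (2 * eps + (x%:R / (Z%:R ^+ 2) + len%:R) / phi) :> R.
Proof.
move=> aq aq' n00 lS lZ.
set H1 := ((x %/ (n0 + len)).+1 - lo)%N; set H2 := ((x %/ n0).+1 - lo)%N.
have Hl l : (l < len)%N -> (H1 <= (x %/ (n0 + l)).+1 - lo <= H2)%N.
  move=> ll; apply/andP; split; rewrite leq_sub2r // ltnS leq_div2l //.
  - by rewrite addn_gt0 n00.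
  - by rewrite leq_add2l ltnW.
  - by rewrite leq_addr.
have H12 : (H1 <= H2)%N by rewrite leq_sub2r // ltnS leq_div2l // leq_addr.
apply: (@le_trans _ _ (box_count q a n0 len lo H2)%:R).
  rewrite ler_nat box_count_rows; apply: leq_sum => l _.
  have /andP[_ h] := Hl l (ltn_ord l).
  by rewrite (row_count_cat _ _ _ h) leq_addr.
apply: le_trans (box_eps n0 lo H2 aq aq' lS) _.
have -> : box_count q a' n0 len lo H2 =
    (box_count q a' n0 len lo H1 + box_count q a' n0 len (lo + H1) (H2 - H1))%N.
  rewrite !box_count_rows -big_split /=; apply: eq_bigr => l _.
  by rewrite (row_count_cat _ _ _ H12).
have I : (box_count q a' n0 len lo H1 <=
   \sum_(l < len) row_count q a' (n0 + l) lo ((x %/ (n0 + l)).+1 - lo))%N.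
  rewrite box_count_rows; apply: leq_sum => l _.
  have /andP[h _] := Hl l (ltn_ord l).
  by rewrite (row_count_cat _ _ _ h) leq_addr.
have U := box_count_upper n0 (lo + H1) (H2 - H1) aq' lS.
rewrite natrD.
have I' : (box_count q a' n0 len lo H1)%:R <= (\sum_(l < len) row_count q a' (n0 + l) lo ((x %/ (n0 + l)).+1 - lo))%N%:R :> R by rewrite ler_nat.
have B : (len * (H2 - H1))%:R / phi <= (x%:R / (Z%:R ^+ 2) + len%:R) / phi.
  rewrite ler_pM2r ?invr_gt0 // natrM.
  have h : (H2 - H1)%:R <= x%:R / n0%:R - x%:R / (n0 + len)%:R + 1 :> R.
    have n0R : 0 < n0%:R :> R by rewrite ltr0n.
    have n1R : 0 < (n0 + len)%:R :> R by rewrite ltr0n addn_gt0 n00.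
    have h1 : (H2 - H1)%:R <= (x %/ n0)%:R - (x %/ (n0 + len))%:R :> R.
      rewrite -natrB; last by rewrite leq_div2l // leq_addr.
      by rewrite ler_nat /H1 /H2; lia.
    have h2 : (x %/ n0)%:R <= x%:R / n0%:R :> R.
      by rewrite ler_pdivlMr // -natrM ler_nat leq_trunc_div.
    have h3 : x%:R / (n0 + len)%:R <= (x %/ (n0 + len))%:R + 1 :> R.
      rewrite ler_pdivrMr // natr1 -natrM ler_nat ltnW // ltn_ceil //.
      by rewrite addn_gt0 n00.
    lra.
  have l0 : 0 <= len%:R :> R by rewrite ler0n.
  apply: le_trans (ler_wpM2l l0 h) _; rewrite mulrDr mulr1 lerD2r.
  have ZR : 0 < Z%:R :> R by rewrite ltr0n.
  have nR : 0 < n0%:R :> R by rewrite ltr0n.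
  have lZR : len%:R * Z%:R <= n0%:R :> R by rewrite -natrM ler_nat.
  have xR : 0 <= x%:R :> R by rewrite ler0n.
  rewrite natrD; move: (len%:R : R) (Z%:R : R) (n0%:R : R) (x%:R : R) l0 ZR nR lZR xR.
  move=> l z n y l0 z0 n1 lz y0.
  have E : l * (y / n - y / (n + l)) = y * (l ^+ 2 / (n * (n + l))).
    by field; rewrite !gt_eqF // ltr_wpDr.
  rewrite E ler_wpM2l // ler_pdivrMr ?mulr_gt0 ?ltr_wpDr // mulrC ler_pdivlMr ?exprn_gt0 //.
  rewrite -exprMn expr2; have lz0 : 0 <= l * z by rewrite mulr_ge0 // ltW.
  by have := ler_pM lz0 lz0 lz lz; nra.
lra.
Qed.

(** The rows below [Z] differ by at most one each.  The others are cut into [J Z] blocks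
    of relative length at most [1 / Z], so that the box lost at the boundary of
    a block contains about [x / Z^2] points. *)
Lemma rows_diff (a a' lo : nat) : coprime a q -> coprime a' q -> (0 < J)%N ->
  (hyperbola_rows q a x S lo)%:R <= (hyperbola_rows q a' x S lo)%:R +
    (Z%:R + 2 * (J * Z)%:R * eps + (J%:R * x%:R / Z%:R + S%:R) / phi) :> R.
Proof.
move=> aq aq' J0.
have split b : hyperbola_rows q b x S lo =
  (\sum_(1 <= d < Z) row_count q b d lo ((x %/ d).+1 - lo) +
   \sum_(j < J) \sum_(i < Z) \sum_(l < 2 ^ j)
     row_count q b (2 ^ j * (Z + i) + l) lo ((x %/ (2 ^ j * (Z + i) + l)).+1 - lo))%N.
  rewrite /hyperbola_rows (@big_cat_nat _ _ _ Z) //=; last first.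
    by rewrite SE leq_pmull // expn_gt0.
  by rewrite SE (@sum_dyadic_split nat).
rewrite !split !natrD.
have head : (\sum_(1 <= d < Z) row_count q a d lo ((x %/ d).+1 - lo))%N%:R <=
   (\sum_(1 <= d < Z) row_count q a' d lo ((x %/ d).+1 - lo))%N%:R + Z%:R :> R.
  rewrite -natrD ler_nat.
  apply: (@leq_trans (\sum_(1 <= d < Z) (row_count q a' d lo ((x %/ d).+1 - lo) + 1))).
    by apply: leq_sum => d _; rewrite addn1 row_count_diff.
  by rewrite big_split /= leq_add2l sum_nat_const_nat muln1 leq_subr.
set A := (\sum_(j < J) _)%N; set A' := (\sum_(j < J) _)%N.
suff tail : A%:R <= A'%:R + (2 * (J * Z)%:R * eps + (J%:R * x%:R / Z%:R + S%:R) / phi) by lra.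
rewrite /A /A' !natr_sum.
apply: (@le_trans _ _ (\sum_(j < J) \sum_(i < Z)
   ((\sum_(l < 2 ^ j) row_count q a' (2 ^ j * (Z + i) + l) lo ((x %/ (2 ^ j * (Z + i) + l)).+1 - lo))%N%:R
     + (2 * eps + (x%:R / (Z%:R ^+ 2) + (2 ^ j)%:R) / phi)))).
  apply: ler_sum => j _; rewrite natr_sum; apply: ler_sum => i _.
  apply: block_rows_diff => //.
  - by rewrite muln_gt0 expn_gt0 addn_gt0 Z_gt0.
  - rewrite SE -{1}[(2 ^ j)%N]muln1 leq_mul // leq_exp2l // ltnW //.
  - by rewrite leq_mul2l leq_addr orbT.
have -> : forall F : 'I_J -> 'I_Z -> nat, forall g : 'I_J -> R,
   \sum_(j < J) \sum_(i < Z) ((F j i)%:R + g j) =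
   \sum_(j < J) (\sum_(i < Z) F j i)%N%:R + \sum_(j < J) (Z%:R * g j).
  move=> F g; rewrite -big_split /=; apply: eq_bigr => j _.
  by rewrite big_split /= natr_sum sumr_const card_ord mulr_natl.
rewrite lerD2l -mulr_sumr.
have -> : \sum_(j < J) (2 * eps + (x%:R / Z%:R ^+ 2 + (2 ^ j)%:R) / phi) =
   J%:R * (2 * eps + x%:R / Z%:R ^+ 2 / phi) + (2 ^ J - 1)%:R / phi :> R.
  have -> : (2 ^ J - 1)%:R = \sum_(j < J) (2 ^ j)%:R :> R.
    rewrite -natr_sum; congr (_%:R); elim: (J) => [|k IHk]; first by rewrite big_ord0.
    rewrite big_ord_recr /= -IHk expnS; have : (0 < 2 ^ k)%N by rewrite expn_gt0. lia.
  rewrite (eq_bigr (fun j : 'I_J => 2 * eps + x%:R / Z%:R ^+ 2 / phi + (2 ^ j)%:R / phi)).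
    by rewrite big_split /= sumr_const card_ord [J%:R * _]mulr_natl mulr_suml.
  by move=> j _; rewrite -addrA; congr (_ + _); rewrite mulrDl.
have h : Z%:R * (2 ^ J - 1)%:R <= S%:R :> R.
  by rewrite -natrM ler_nat SE mulnC leq_mul2r leq_subr orbT.
have ZR : Z%:R != 0 :> R by rewrite pnatr_eq0 -lt0n.
have -> : Z%:R * (J%:R * (2 * eps + x%:R / Z%:R ^+ 2 / phi) + (2 ^ J - 1)%:R / phi) =
  2 * (J * Z)%:R * eps + J%:R * x%:R / Z%:R / phi + Z%:R * (2 ^ J - 1)%:R / phi.
  have phin0 : phi != 0 by rewrite gt_eqF.
  rewrite natrM; move: ((2 ^ J - 1)%:R : R) => w; field; by rewrite ZR phin0.
by rewrite [X in _ <= _ + X]mulrDl addrA lerD2l ler_pM2r // invr_gt0.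
Qed.

Lemma hyperbola_diff (a a' : nat) : coprime a q -> coprime a' q -> (0 < J)%N ->
  (x < S * S)%N -> (S <= x.+1)%N ->
  `|(hyperbola_count q a x)%:R - (hyperbola_count q a' x)%:R| <=
    2 * (Z%:R + 2 * (J * Z)%:R * eps + (J%:R * x%:R / Z%:R + S%:R) / phi) :> R.
Proof.
move=> aq aq' J0 xS Sx.
have S0 : (0 < S)%N by rewrite SE muln_gt0 expn_gt0 Z_gt0.
rewrite !(hyperbola_split _ _ xS Sx S0) !natrD ler_norml.
have h1 := rows_diff 1 aq aq' J0; have h2 := rows_diff S aq aq' J0.
have h3 := rows_diff 1 aq' aq J0; have h4 := rows_diff S aq' aq J0.
by apply/andP; split; lra.
Qed.

End Dissection.

(** * Sizes of the bounds as powers of X *)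

Section PowerBookkeeping.
Variables (R : realType) (X : R).
Hypothesis X2 : 2 <= X.

Lemma powX_base_gt0 : 0 < X.
Proof. exact: lt_le_trans X2. Qed.

Lemma powX_base_ge1 : 1 <= X.
Proof. by apply: le_trans X2; rewrite ler1n. Qed.

Lemma powXD (a b : R) : X `^ a * X `^ b = X `^ (a + b).
Proof.
have X0 : X != 0 by rewrite gt_eqF // powX_base_gt0.
by rewrite powRD // X0 implybT.
Qed.

Lemma powX_le (a b : R) : a <= b -> X `^ a <= X `^ b.
Proof. by move=> ab; apply: ler_powR => //; exact: powX_base_ge1. Qed.

Lemma powX_ge1 (a : R) : 0 <= a -> 1 <= X `^ a.
Proof. by move=> a0; rewrite -(powRr0 X) powX_le. Qed.

Lemma powX_ge0 (a : R) : 0 <= X `^ a.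
Proof. exact: powR_ge0. Qed.

Lemma powX1 : X `^ 1 = X.
Proof. by rewrite powRr1 // ltW // powX_base_gt0. Qed.

Lemma powX_exponent (n : nat) : (0 < n)%N -> n%:R = X `^ (ln n%:R / ln X).
Proof.
move=> n0; have X1 : 0 < ln X by rewrite ln_gt0 // (lt_le_trans _ X2) // ltr1n.
rewrite /powR gt_eqF ?powX_base_gt0 //.
by rewrite divfK ?gt_eqF // lnK // posrE ltr0n.
Qed.

Lemma powX_nat (p n : nat) (lam : R) : p%:R = X `^ lam -> (p ^ n)%:R = X `^ (n%:R * lam).
Proof.
by move=> pl; rewrite natrX pl mulrC powRrM powR_mulrn // powX_ge0.
Qed.

(** An exponent is logarithmic in the power, hence smaller than any power. *)
Lemma exponent_bound (s : R) (n : nat) : 0 < s -> (2 ^ n)%:R <= X ->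
  n%:R <= (s * ln 2)^-1 * X `^ s.
Proof.
move=> s0 h; have l2 : 0 < ln 2 :> R by rewrite ln_gt0 // ltr1n.
have h1 : n%:R * ln 2 <= ln X.
  have X0 := powX_base_gt0.
  by rewrite mulrC mulr_natr -lnXn // -natrX ler_ln ?posrE ?ltr0n ?expn_gt0.
have h2 : s * ln X <= X `^ s.
  have := expR_ge1Dx (s * ln X); rewrite /powR gt_eqF ?powX_base_gt0 //; lra.
rewrite mulrC ler_pdivlMr ?mulr_gt0 // mulrCA; nra.
Qed.

End PowerBookkeeping.

Section CorrelationEstimate.
Variables (R : realType) (s : R).
Hypotheses (s_gt0 : 0 < s) (s_small : s * (200 * 200) <= 1).

(** Below [X^(2/3 - 100 s)] the trivial bound is enough.  Above it, the differencing bound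
    applies with [m] about [j / 1000]: the end blocks have exponent [0.74 j lam + 1/2],
    the others [1.499 j lam], and both are less than [1] by a margin when [j lam] is
    close to [2/3]. *)
Lemma correlation_estimate (X : R) (p j L : nat) (lam C0 : R) :
  2 <= X -> prime p -> odd p -> (1 < j)%N ->
  p%:R = X `^ lam -> 0 < lam -> lam * 20 <= s ->
  j%:R * lam <= 2 / 3 + s -> 0 <= C0 -> j%:R <= C0 * X `^ s ->
  L%:R <= 2 * X `^ (1 / 2) ->
  exists E : R, (forall N (v : 'Z_(p ^ j)), cabs (correlation R N L v) <= E) /\
    2 * (j * p)%:R * E <= (16 * C0 + 216 * C0 ^+ 2) * X `^ (1 - 10 * s).
Proof.
move=> X2 p_pr p_odd j1 pl lam0 lams jl C00 jC LX.
have j0 : (0 < j)%N by exact: ltnW.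
pose h := uphalf j.
have hj : (j <= 2 * h)%N by rewrite /h; clear; lia.
have h_lt : (0 < h < j)%N by rewrite /h; clear -j1; lia.
have hl : h%:R * lam <= (j%:R * lam + lam) / 2.
  have hR : 2 * h%:R <= j%:R + 1 :> R by rewrite -natrM natr1 ler_nat /h; clear; lia.
  nra.
have pX n := powX_nat n pl.
have pow0 := powX_ge0 X.
have powD := powXD X2.
have powle := @powX_le R X X2.
have C2 : 0 <= C0 ^+ 2 by rewrite sqr_ge0.
have phX : (p ^ h)%:R <= X `^ ((j%:R * lam + lam) / 2) by rewrite pX powle.
have jpX : (j * p)%:R <= C0 * X `^ (s + lam).
  by rewrite natrM pl -powD mulrA ler_wpM2r.
have jp0 : 0 <= (j * p)%:R :> R by rewrite ler0n.
have ph0 : 0 <= (p ^ h)%:R :> R by rewrite ler0n.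
set tau := j%:R * lam in jl hl phX *.
have [tau_small|tau_big] := lerP tau (2 / 3 - 100 * s).
  exists (2 * ((p ^ j)%:R * (j * p)%:R) * (2 * p ^ h)%:R); split.
    by move=> N v; apply: correlation_trivial.
  rewrite (natrM R 2) pX -/tau.
  have -> : 2 * (j * p)%:R * (2 * (X `^ tau * (j * p)%:R) * (2 * (p ^ h)%:R)) =
    8 * ((j * p)%:R * (j * p)%:R * X `^ tau * (p ^ h)%:R) :> R by ring.
  apply: (@le_trans _ _ (8 * ((C0 * X `^ (s + lam)) * (C0 * X `^ (s + lam)) * X `^ tau
       * X `^ ((tau + lam) / 2)))).
    rewrite ler_pM2l //; apply: ler_pM => //; first by rewrite !mulr_ge0.
    by apply: ler_wpM2r => //; apply: ler_pM.
  have -> : C0 * X `^ (s + lam) * (C0 * X `^ (s + lam)) * X `^ tau * X `^ ((tau + lam) / 2)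
     = C0 ^+ 2 * (X `^ (s + lam) * X `^ (s + lam) * X `^ tau * X `^ ((tau + lam) / 2)).
    by ring.
  rewrite !powD.
  have e1 : X `^ (s + lam + (s + lam) + tau + (tau + lam) / 2) <= X `^ (1 - 10 * s).
    by apply: powle; lra.
  have e2 := ler_wpM2l C2 e1; have e3 := pow0 (1 - 10 * s).
  have := mulr_ge0 C00 e3; have := mulr_ge0 C2 e3; nra.
have [K EK] : exists K : nat, K = (50 * 20)%N by eexists.
have KR : K%:R = 50 * 20 :> R by rewrite EK natrM.
pose m := (j %/ K)%N.
have K0 : (0 < K)%N by rewrite EK.
have mj : (m * K <= j)%N by rewrite leq_trunc_div.
have jm : (j < m.+1 * K)%N by rewrite ltn_ceil.
have m_big : (17 * 20 <= m)%N.
  rewrite leqNgt; apply/negP => mlt.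
  have : (j <= 17 * 20 * K)%N.
    by apply: leq_trans (ltnW jm) _; rewrite leq_mul2r mlt orbT.
  rewrite -(ler_nat R) !natrM KR => jle.
  have tau_le : tau <= 17 * 20 * (50 * 20) * lam by rewrite /tau ler_wpM2r // ltW.
  have absurd (t : R) : t <= 17 * 20 * (50 * 20) * lam -> 2 / 3 - 100 * s < t -> t < t.
    by move: s_small lams; clear; lra.
  by have := absurd _ tau_le tau_big; rewrite ltxx.
have kap_ge : (50 * (20 * m) <= j)%N by rewrite mulnA -EK mulnC.
have kap_lt : (j < 50 * (20 * m.+1))%N by rewrite mulnA -EK mulnC.
have mjR : m%:R * (50 * 20) <= j%:R :> R by rewrite -KR -natrM ler_nat.
have jmR : j%:R <= (m%:R + 1) * (50 * 20) :> R.
  by rewrite -KR natr1 -natrM ler_nat ltnW.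
have p0 : (0 < p)%N := prime_gt0 p_pr.
have Dn0 : (p ^ m)%:R != 0 :> R by rewrite pnatr_eq0 -lt0n expn_gt0 p0.
have qE : (p ^ j = p ^ (j - 12 * (20 * m)) * (p ^ (3 * (20 * m)) * p ^ (9 * (20 * m))))%N.
  by rewrite -!expnD; congr (_ ^ _)%N; clear -kap_ge; lia.
have r0 : (0 < 9 * (20 * m))%N by clear -m_big; lia.
have r6 : (j <= 9 * (20 * m) * 6)%N by clear -kap_lt m_big; lia.
have T0 : (0 < p ^ (3 * (20 * m)))%N by rewrite expn_gt0 p0.
have phase := fun th b c0 c1 n =>
  @quintic_phase_sum R p j m p_pr p_odd m_big kap_ge kap_lt th b c0 c1 n.
have corr N v := @correlation_blocks R p j h p_pr p_odd j0 hj h_lt _ _ _ N L _ v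
  T0 r0 r6 qE phase.
set E := (2 * p ^ h)%:R * _ in corr.
exists E; split; first by move=> N v; exact: corr.
set D := (p ^ m)%:R : R in Dn0.
have TD : (p ^ (3 * (20 * m)))%:R = D ^+ 60 by rewrite mulnA mulnC expnM natrX.
have UE : (p ^ (3 * (20 * m)) * p ^ (9 * (20 * m)) = p ^ (12 * 20 * m))%N.
  by rewrite -expnD; congr (_ ^ _)%N; clear; lia.
pose mu := m%:R * lam.
have mu_le : mu * (50 * 20) <= tau.
  by rewrite /mu /tau mulrAC ler_wpM2r // ltW.
have mu_ge : tau <= (mu + lam) * (50 * 20).
  have -> : (mu + lam) * (50 * 20) = (m%:R + 1) * (50 * 20) * lam.
    by rewrite /mu; move: (m%:R : R) => y; ring.
  by rewrite /tau ler_wpM2r // ltW.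
have UX : (p ^ (12 * 20 * m))%:R = X `^ (12 * 20 * mu).
  by rewrite pX /mu natrM natrM mulrA.
have DX : D = X `^ mu by rewrite /D pX.
have EE : E = 2 * (p ^ h)%:R * (2 * X `^ (12 * 20 * mu) * L%:R
             + 54 * X `^ (tau - mu) * (j * p)%:R).
  rewrite /E TD UE UX (natrM R 2); congr (_ * (_ + _)).
  have -> : X `^ (tau - mu) = (p ^ j)%:R / D by rewrite DX pX -powRN powD.
  move: ((p ^ j)%:R : R) ((j * p)%:R : R) => y z.
  by rewrite (exprSr D 59); field; exact: Dn0.
clear corr phase.
have exponents (t u : R) : t <= 2 / 3 + s -> u * (50 * 20) <= t ->
    t <= (u + lam) * (50 * 20) ->
    s + lam + (t + lam) / 2 + (12 * 20 * u + 1 / 2) <= 1 - 10 * s /\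
    s + lam + (s + lam) + (t + lam) / 2 + (t - u) <= 1 - 10 * s.
  by move: s_gt0 s_small lams; clear => *; split; lra.
have [e1 e2] := exponents _ _ jl mu_le mu_ge.
have b1 : (j * p)%:R * (p ^ h)%:R * (X `^ (12 * 20 * mu) * L%:R)
    <= 2 * C0 * X `^ (1 - 10 * s).
  apply: (@le_trans _ _ (C0 * X `^ (s + lam) * X `^ ((tau + lam) / 2)
      * (X `^ (12 * 20 * mu) * (2 * X `^ (1 / 2))))).
    apply: ler_pM; [by rewrite mulr_ge0|by rewrite mulr_ge0| |].
      exact: ler_pM.
    exact: ler_wpM2l.
  have -> : C0 * X `^ (s + lam) * X `^ ((tau + lam) / 2)
      * (X `^ (12 * 20 * mu) * (2 * X `^ (1 / 2))) = 2 * C0 *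
      (X `^ (s + lam) * X `^ ((tau + lam) / 2) * (X `^ (12 * 20 * mu) * X `^ (1 / 2))).
    by move: (X `^ _) (X `^ _) (X `^ _) (X `^ _) => x1 x2 x3 x4; ring.
  rewrite !powD; apply: ler_wpM2l; [by rewrite mulr_ge0|exact: powle].
have b2 : (j * p)%:R * (j * p)%:R * (p ^ h)%:R * X `^ (tau - mu)
    <= C0 ^+ 2 * X `^ (1 - 10 * s).
  apply: (@le_trans _ _ (C0 * X `^ (s + lam) * (C0 * X `^ (s + lam))
      * X `^ ((tau + lam) / 2) * X `^ (tau - mu))).
    apply: ler_wpM2r => //; apply: ler_pM => //; first by rewrite mulr_ge0.
    exact: ler_pM.
  have -> : C0 * X `^ (s + lam) * (C0 * X `^ (s + lam))
      * X `^ ((tau + lam) / 2) * X `^ (tau - mu) = C0 ^+ 2 *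
      (X `^ (s + lam) * X `^ (s + lam) * X `^ ((tau + lam) / 2) * X `^ (tau - mu)).
    by move: (X `^ _) (X `^ _) (X `^ _) => x1 x2 x3; ring.
  rewrite !powD; apply: ler_wpM2l; [exact: C2|exact: powle].
rewrite EE; move: b1 b2; clear.
move: ((j * p)%:R : R) ((p ^ h)%:R : R) (X `^ (12 * 20 * mu)) (L%:R : R) (X `^ (tau - mu))
  (X `^ (1 - 10 * s)) => x1 x2 x3 x4 x5 x6 b1 b2.
have -> : 2 * x1 * (2 * x2 * (2 * x3 * x4 + 54 * x5 * x1)) =
  8 * (x1 * x2 * (x3 * x4)) + 216 * (x1 * x1 * x2 * x5) by ring.
lra.
Qed.

End CorrelationEstimate.

(** * Comparison of two residue classes *)

Section BoxEstimate.
Variables (R : realType) (s : R).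
Hypotheses (s_gt0 : 0 < s) (s_small : s * (200 * 200) <= 1).

Local Notation C0 := ((s * ln 2)^-1 : R).
Local Notation C1 := (16 * C0 + 216 * C0 ^+ 2).

Lemma exponent_constant_ge0 : 0 <= C0.
Proof. by rewrite invr_ge0 mulr_ge0 ?(ltW s_gt0) // ln_ge0 // ler1n. Qed.

Lemma s_le_third : s <= 1 / 3.
Proof. move: s_gt0 s_small => sg sl; lra. Qed.

Lemma box_estimate (X : R) (p k N L M H a a' : nat) :
  2 <= X -> prime p -> odd p -> (1 < k)%N -> 20 <= s * k%:R ->
  (p ^ k)%:R <= X `^ (2 / 3 + s) -> L%:R <= 2 * X `^ (1 / 2) ->
  coprime a (p ^ k) -> coprime a' (p ^ k) ->
  `|(box_count (p ^ k) a N L M H)%:R - (box_count (p ^ k) a' N L M H)%:R|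
    <= (2 + 2 * C0 * C1) * X `^ (1 - 9 * s) / (p ^ k)%:R.
Proof.
move=> X2 p_pr p_odd k1 sk qX LX aq aq'.
have s1 := s_le_third; have sg := s_gt0; have sl := s_small.
have C0_ge0 := exponent_constant_ge0.
have C1_ge0 : 0 <= C1 by rewrite addr_ge0 ?mulr_ge0 ?sqr_ge0.
have k0 : (0 < k)%N := ltnW k1.
have p0 := prime_gt0 p_pr.
have X0 := powX_base_gt0 X2.
have lnX0 : 0 < ln X by rewrite ln_gt0 // (lt_le_trans _ X2) // ltr1n.
have powD := powXD X2; have powle := @powX_le R X X2; have pow0 := powX_ge0 X.
set lam := ln p%:R / ln X.
have pl : p%:R = X `^ lam := powX_exponent X2 p0.
have lam0 : 0 < lam by rewrite divr_gt0 // ln_gt0 // ltr1n prime_gt1.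
have klam : k%:R * lam <= 2 / 3 + s.
  have := qX; rewrite (powX_nat k pl) => h.
  have : ln (X `^ (k%:R * lam)) <= ln (X `^ (2 / 3 + s)).
    by rewrite ler_ln // posrE powR_gt0.
  by rewrite !ln_powR ler_pM2r.
have lams : lam * 20 <= s.
  apply: (@le_trans _ _ (lam * (s * k%:R))); first by rewrite ler_wpM2l // ltW.
  rewrite mulrCA [lam * _]mulrC -[X in _ <= X]mulr1 ler_wpM2l ?(ltW s_gt0) //.
  by apply: le_trans klam _; lra.
have qX1 : (p ^ k)%:R <= X.
  by apply: le_trans qX _; rewrite -{2}(powX1 X2) powle //; lra.
have jC j : (j <= k)%N -> j%:R <= C0 * X `^ s.
  move=> jk; apply: exponent_bound => //.
  apply: le_trans qX1; rewrite ler_nat.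
  apply: (@leq_trans (2 ^ k)); first by rewrite leq_exp2l.
  by rewrite leq_exp2r // prime_gt1.
have cop b : coprime b (p ^ k) = ~~ (p %| b)%N.
  by rewrite coprime_sym coprime_pexpl // prime_coprime.
rewrite !cop in aq aq'.
set e := C1 * X `^ (1 - 10 * s).
have e0 : 0 <= e by rewrite mulr_ge0.
have He j b : (1 < j <= k)%N -> ~~ (p %| b)%N ->
    `|(box_count (p ^ j) b N L M H)%:R - (box_count (p ^ j.-1) b N L M H)%:R / p%:R|
       * (p ^ j)%:R <= e.
  move=> /andP[j1 jk] pb; have j0 : (0 < j)%N := ltnW j1.
  have jl : j%:R * lam <= 2 / 3 + s.
    by apply: le_trans klam; rewrite ler_wpM2r ?(ltW lam0) // ler_nat.
  have [E [HE E1]] := correlation_estimate s_gt0 s_small X2 p_pr p_odd j1 pl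
    lam0 lams jl C0_ge0 (jC j jk) LX.
  have hj : (j <= 2 * uphalf j)%N by clear; lia.
  have h_lt : (0 < uphalf j < j)%N by clear -j1; lia.
  have D := box_count_descent p_pr p_odd j0 hj h_lt M H pb j1 (HE N).
  have q0 : 0 < (p ^ j)%:R :> R by rewrite ltr0n expn_gt0 p0.
  by move: D; rewrite ler_pdivlMr // => D; apply: le_trans D E1.
have T := box_count_telescope p_pr e0 He k0 aq aq'.
have q0 : 0 < (p ^ k)%:R :> R by rewrite ltr0n expn_gt0 p0.
rewrite ler_pdivlMr //; apply: le_trans T _.
rewrite [X in _ <= X]mulrDl; apply: lerD.
  rewrite natrM pl; apply: (@le_trans _ _ (X `^ lam * (2 * X `^ (1 / 2)))).
    by rewrite ler_wpM2l.
  rewrite mulrCA powD ler_pM2l // powle //.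
  by lra.
apply: (@le_trans _ _ (2 * (C0 * X `^ s) * e)).
  by apply: ler_wpM2r => //; apply: ler_wpM2l => //; exact: jC.
have -> : 2 * (C0 * X `^ s) * e = 2 * C0 * C1 * (X `^ s * X `^ (1 - 10 * s)).
  by rewrite /e; move: (X `^ _) (X `^ _) => y z; ring.
rewrite powD; apply: ler_wpM2l; first by rewrite !mulr_ge0.
by apply: powle; lra.
Qed.

(** The dissection parameter is [Z = X^(5 s)]: the boundary costs [X^(1 - 4 s)] and the
    [X^(6 s)] boxes cost [X^(1 - 9 s)] each, all divided by the modulus. *)
Lemma hyperbola_estimate : exists2 C : R, 0 < C &
  forall (X : R) (p k a a' : nat),
  2 <= X -> prime p -> odd p -> (1 < k)%N -> 20 <= s * k%:R ->
  (p ^ k)%:R <= X `^ (2 / 3 + s) ->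
  coprime a (p ^ k) -> coprime a' (p ^ k) ->
  `|(hyperbola_count (p ^ k) a (Num.truncn X))%:R
    - (hyperbola_count (p ^ k) a' (Num.truncn X))%:R|
    <= C * (X / (p ^ k)%:R `^ (1 + s)).
Proof.
have C0_ge0 := exponent_constant_ge0.
have C1_ge0 : 0 <= C1 by rewrite addr_ge0 ?mulr_ge0 ?sqr_ge0.
set C2 := 2 + 2 * C0 * C1.
have C2_ge0 : 0 <= C2 by rewrite addr_ge0 // !mulr_ge0.
have K0 : 0 <= (C0 + 1) * C2 by apply: mulr_ge0 => //; apply: addr_ge0.
exists (2 * (1 + 2 * ((C0 + 1) * C2) + 2 * (2 * (C0 + 1) + 2))); first by lra.
move=> X p k a a' X2 p_pr p_odd k1 sk qX aq aq'.
have sg := s_gt0; have sl := s_small.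
have powD := powXD X2; have powle := @powX_le R X X2; have pow0 := powX_ge0 X.
have p0 := prime_gt0 p_pr; have k0 := ltnW k1.
have q_gt1 := ppow_gt1 p_pr k0.
have X0 := powX_base_gt0 X2.
set x := Num.truncn X.
have xX : x%:R <= X by rewrite truncn_le ltW.
have x2 : (2 <= x)%N by rewrite (truncn_ge_nat _ (ltW X0)).
set Y := X `^ (5 * s).
have Y1 : 1 <= Y by apply: powX_ge1 => //; lra.
pose Z := Num.truncn Y.
have Z0 : (0 < Z)%N by rewrite truncn_gt0.
have ZR0 : 0 < Z%:R :> R by rewrite ltr0n.
have ZY : Z%:R <= Y by rewrite truncn_le; lra.
have YZ : Y <= 2 * Z%:R.
  have := truncnS_gt Y; rewrite -/Z -natr1.
  have : 1 <= Z%:R :> R by rewrite ler1n.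
  lra.
have ZZ : (Z * Z <= x)%N.
  rewrite (truncn_ge_nat _ (ltW X0)) natrM; apply: (@le_trans _ _ (Y * Y)).
    by apply: ler_pM => //; rewrite ler0n.
  by rewrite /Y powD -[X in _ <= X](powX1 X2); apply: powle; lra.
(* the least number of dyadic ranges that reaches beyond the square root of [x] *)
have exJ : exists j, (x < (2 ^ j * Z) * (2 ^ j * Z))%N.
  exists x; apply: (leq_trans (ltn_expl x (isT : (1 < 2)%N))).
  have h : (0 < 2 ^ x)%N by rewrite expn_gt0.
  by rewrite -{1}[(2 ^ x)%N]muln1 leq_mul ?leq_pmulr ?muln_gt0 ?h.
case: (ex_minnP exJ) => J xS Jmin.
have J0 : (0 < J)%N.
  by case: J xS {Jmin} => //; rewrite !mul1n ltnNge ZZ.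
have SJ : (2 ^ J.-1 * Z * (2 ^ J.-1 * Z) <= x)%N.
  by rewrite leqNgt; apply/negP => /Jmin; case: (J) J0 => // j _; rewrite ltnn.
set S := (2 ^ J * Z)%N in xS.
have SE : S = (2 * (2 ^ J.-1 * Z))%N by rewrite /S mulnA -expnS prednK.
have S4 : (S * S <= 4 * x)%N.
  rewrite SE; move: SJ; clear; move: (2 ^ J.-1 * Z)%N => y; lia.
have Sx : (S <= x.+1)%N by move: S4 x2; clear; move: S x => y z; nia.
have SX : S%:R <= 2 * X `^ (1 / 2).
  have h0 : 0 <= 2 * X `^ (1 / 2) by rewrite mulr_ge0.
  rewrite -(@ler_pXn2r _ 2) ?nnegrE ?ler0n // exprMn !expr2 powD.
  have -> : 1 / 2 + 1 / 2 = 1 :> R by lra.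
  rewrite (powX1 X2) -natrM; apply: (@le_trans _ _ (4 * x)%:R); first by rewrite ler_nat.
  by rewrite natrM; lra.
have JX : J%:R <= (C0 + 1) * X `^ s.
  have h : (J.-1)%:R <= C0 * X `^ s.
    apply: exponent_bound => //; apply: le_trans xX; rewrite ler_nat.
    apply: leq_trans SJ; have h : (0 < 2 ^ J.-1)%N by rewrite expn_gt0.
    by rewrite -{1}[(2 ^ J.-1)%N]muln1 leq_mul ?leq_pmulr ?muln_gt0 ?h.
  have h1 : 1 <= X `^ s by apply: powX_ge1 => //; lra.
  by rewrite -(prednK J0) -natr1; lra.
set Q := (p ^ k)%:R : R.
have Q0 : 0 < Q by rewrite ltr0n ltnW.
set W := X `^ (1 - 3 * s).
have W0 : 0 <= W := pow0 _.
set eps := C2 * X `^ (1 - 9 * s) / Q.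
have eps0 : 0 <= eps by rewrite divr_ge0 ?mulr_ge0 // ltW.
have box b b' N L M H : coprime b (p ^ k) -> coprime b' (p ^ k) -> (L <= S)%N ->
   (box_count (p ^ k) b N L M H)%:R <= (box_count (p ^ k) b' N L M H)%:R + eps :> R.
  move=> bq bq' LS.
  have LX : L%:R <= 2 * X `^ (1 / 2) by apply: le_trans SX; rewrite ler_nat.
  have := box_estimate N M H X2 p_pr p_odd k1 sk qX LX bq bq'.
  by rewrite -/C2 -/Q -/eps ler_norml => /andP[_]; lra.
apply: le_trans (hyperbola_diff q_gt1 Z0 (erefl S) box aq aq' J0 xS Sx) _.
set phi := (totient (p ^ k))%:R : R.
have phiQ : Q <= 2 * phi.
  rewrite /Q /phi -natrM ler_nat totient_pfactor // -{1}(prednK k0) expnS mulnA.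
  by rewrite leq_mul2r; apply/orP; right; have := p_ge3 p_pr p_odd; clear; lia.
have phi0 : 0 < phi by lra.
have t1 : Z%:R <= W / Q.
  rewrite ler_pdivlMr //; apply: (@le_trans _ _ (Y * X `^ (2 / 3 + s))).
    by apply: ler_pM => //; rewrite ltW.
  by rewrite /Y powD; apply: powle; lra.
have t2 : (J * Z)%:R * eps <= (C0 + 1) * C2 * (W / Q).
  have -> : (C0 + 1) * C2 * (W / Q) = (C0 + 1) * X `^ s * Y * eps.
    rewrite /W /eps (_ : 1 - 3 * s = s + 5 * s + (1 - 9 * s)); last by lra.
    by rewrite -!powD -/Y; move: (X `^ _) (X `^ _) (Q^-1) => y z t; ring.
  by rewrite natrM; apply: ler_wpM2r => //; apply: ler_pM; rewrite ?ler0n.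
have t3 : J%:R * x%:R / Z%:R <= 2 * (C0 + 1) * W.
  rewrite ler_pdivrMr //.
  apply: (@le_trans _ _ ((C0 + 1) * X `^ s * X)).
    by apply: ler_pM; rewrite ?ler0n.
  have e1 : X `^ s * X <= W * Y.
    by rewrite -{2}(powX1 X2) /W /Y !powD; apply: powle; lra.
  have e2 : W * Y <= W * (2 * Z%:R) by apply: ler_wpM2l.
  have c1 : 0 <= C0 + 1 by lra.
  have := ler_wpM2l c1 (le_trans e1 e2).
  move: (X `^ s) => y; lra.
have t4 : S%:R <= 2 * W.
  by apply: le_trans SX _; rewrite ler_pM2l // powle //; lra.
have t5 : (J%:R * x%:R / Z%:R + S%:R) / phi <= 2 * (2 * (C0 + 1) + 2) * (W / Q).
  rewrite ler_pdivrMr //.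
  apply: (@le_trans _ _ ((2 * (C0 + 1) + 2) * W)); first by lra.
  have -> : 2 * (2 * (C0 + 1) + 2) * (W / Q) * phi =
    (2 * (C0 + 1) + 2) * W * ((2 * phi) / Q) by ring.
  rewrite ler_peMr //; first by apply: mulr_ge0 => //; lra.
  by rewrite ler_pdivlMr // mul1r.
have t6 : W / Q <= X / Q `^ (1 + s).
  have Qn0 : Q != 0 by rewrite gt_eqF.
  rewrite powRD ?Qn0 ?implybT //.
  rewrite powRr1 ?(ltW Q0) // invfM mulrA [X / Q * _]mulrAC ler_pM2r ?invr_gt0 //.
  have Qs : Q `^ s <= X `^ (3 * s).
    apply: (@le_trans _ _ ((X `^ (2 / 3 + s)) `^ s)).
      by apply: ge0_ler_powR; rewrite ?nnegrE ?(ltW sg) ?(ltW Q0).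
    by rewrite -powRrM; apply: powle; nra.
  rewrite ler_pdivlMr ?powR_gt0 //.
  apply: le_trans (ler_wpM2l W0 Qs) _.
  by rewrite /W powD -[X in _ <= X](powX1 X2); apply: powle; lra.
have cst0 : 0 <= 2 * (1 + 2 * ((C0 + 1) * C2) + 2 * (2 * (C0 + 1) + 2)) by lra.
apply: le_trans (ler_wpM2l cst0 t6).
have -> : 2 * (J * Z)%:R * eps = 2 * ((J * Z)%:R * eps) by rewrite mulrA.
lra.
Qed.

End BoxEstimate.

Section ResidueAverage.
Local Open Scope nat_scope.

Lemma divisor_sum_coprimeE (R : realType) (X : R) (q : nat) : 1 < q ->
  divisor_sum_coprime X q = \sum_(b < q | coprime b q) hyperbola_count q b (Num.truncn X).
Proof.
move=> q1; rewrite /divisor_sum_coprime.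
under [RHS]eq_bigr do rewrite -divisor_sum_hyperbola big_mkcond /=.
rewrite exchange_big /= big_mkcond /=; apply: eq_bigr => n _.
have nq : n %% q < q by rewrite ltn_mod ltnW.
have [c|nc] := boolP (coprime n q).
  rewrite (bigD1 (Ordinal nq)) /= ?coprime_modl // modn_mod eqxx big1 ?addn0 // => b.
  case/andP=> _; rewrite -val_eqE /= => /negbTE bn.
  by rewrite (modn_small (ltn_ord b)) eq_sym bn.
rewrite big1 // => b bq; case: eqP => // E; move: nc.
by rewrite -coprime_modl E coprime_modl bq.
Qed.

End ResidueAverage.

(** * The error term *)

Lemma divisor_sum_apE (R : realType) (X : R) (q : nat) (a : int) : (0 < q)%N ->
  divisor_sum_ap X q a = hyperbola_count q `|(a %% q%:Z)%Z| (Num.truncn X).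
Proof.
move=> q0; rewrite -divisor_sum_hyperbola /divisor_sum_ap; apply: eq_bigl => n.
have a0 : `|(a %% q%:Z)%Z|%N%:Z = (a %% q%:Z)%Z.
  by rewrite gez0_abs // modz_ge0 // -lt0n.
by rewrite -[RHS]eqz_nat -!modz_nat a0 modz_mod.
Qed.

(** The subtracted main term is the mean of the divisor sums over the reduced classes. *)
Lemma divisor_error_average (R : realType) (X : R) (q : nat) (a : int) (B : R) :
  (1 < q)%N -> coprimez a q%:Z ->
  (forall b b' : nat, coprime b q -> coprime b' q ->
    `|(hyperbola_count q b (Num.truncn X))%:R
      - (hyperbola_count q b' (Num.truncn X))%:R| <= B :> R) ->
  `|divisor_error X q a| <= B.
Proof.
move=> q1 aq HB; have q0 := ltnW q1.
set b := `|(a %% q%:Z)%Z|%N.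
have bq : coprime b q.
  have := aq; rewrite /coprimez -gcdz_modl /gcdz absz_nat.
  by rewrite -/b /coprime.
rewrite /divisor_error divisor_sum_apE // -/b divisor_sum_coprimeE //.
set phi := (totient q)%:R : R.
have phi0 : 0 < phi by rewrite ltr0n totient_gt0.
set F := fun c => (hyperbola_count q c (Num.truncn X))%:R : R.
have -> : F b - phi^-1 * (\sum_(c < q | coprime c q) hyperbola_count q c (Num.truncn X))%N%:R
   = phi^-1 * \sum_(c < q | coprime c q) (F b - F c).
  rewrite sumrB sum_coprime_const // mulrBr mulrA mulVf ?gt_eqF // mul1r.
  by rewrite natr_sum.
rewrite normrM gtr0_norm ?invr_gt0 // mulrC ler_pdivrMr // mulrC.
apply: le_trans (ler_norm_sum _ _ _) _.
rewrite -sum_coprime_const //.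
by apply: ler_sum => c cq; exact: HB.
Qed.

Theorem theorem1p1 (R : realType) :
  exists (k0 : nat) (sigma c : R),
    [/\ (1 <= k0)%N, 0 < sigma, 0 < c &
      forall (X : R) (q p k : nat) (a : int),
        2 <= X ->
        prime p -> odd p -> (k0 <= k)%N -> q = (p ^ k)%N ->
        q%:R <= X `^ (2 / 3 + sigma) ->
        coprimez a q%:Z ->
        `|divisor_error X q a| <= c * (X / q%:R `^ (1 + sigma))].
Proof.
(* [20 <= s k] makes [p] at most [X^(s / 20)], which pays for all powers of [p] lost *)
have [K KE] : exists K : nat, K = (20 * (200 * 200))%N by eexists.
have KR : K%:R = 20 * (200 * 200) :> R by rewrite KE !natrM.
pose s : R := (200 * 200)^-1.
have s0 : 0 < s by rewrite invr_gt0 mulr_gt0.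
have sE : s * (200 * 200) = 1 by rewrite mulVf // gt_eqF // mulr_gt0.
have s1 : s * (200 * 200) <= 1 by rewrite sE.
have [c c0 Hc] := hyperbola_estimate s0 s1.
have K1 : (1 < K)%N by rewrite KE.
exists K, s, c; split => //; first exact: ltnW.
move=> X q p k a X2 p_pr p_odd kK -> qX aq.
have k1 : (1 < k)%N by exact: leq_trans K1 kK.
have sk : 20 <= s * k%:R.
  apply: (@le_trans _ _ (s * K%:R)); last by rewrite ler_pM2l // ler_nat.
  by rewrite KR mulrCA sE mulr1.
apply: divisor_error_average => //; first exact: ppow_gt1 (ltnW k1).
by move=> b b' bq bq'; exact: Hc.
Qed.
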